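(* Let $\varepsilon>0$, let $p$ be an integer with $2\le p<\infty$ if $d\le2$ and $p=2$ if $d=3$, and let $F$ be a sufficiently smooth function on $\mathbb R$ with $F(0)=0$, $f=F'$. Assume: (a) there are constants $c_0>0$ and $c_1$ with $f(v)v\ge p c_0v^{2p}-c_1$ for all $v\in\mathbb R$; (b) for every $\eta>0$ there is a constant $c_2=c_2(\eta)$ with $|f(v)|\le\eta c_0v^{2p}+c_2$ for all $v\in\mathbb R$; (c) there is a constant $c_3$ with $\frac12c_0v^{2p}-c_3\le F(v)\le\frac32c_0v^{2p}+c_3$ for all $v\in\mathbb R$; (d) there is a constant $c>0$ with $F''(v)\ge-c$ for all $v\in\mathbb R$. Let $R,R_2,\alpha,r>0$ and, with $c_2=c_2(\eta)$ for $\eta=\frac1\alpha(p-\frac32)$, let $$C_0(\alpha)=(c_1+c_2\alpha+c_3)|\Omega|,\qquad C_1(\alpha)=(c_1+c_2\alpha+2c_3)|\Omega|,$$ $$\hat\rho_0=\sqrt{2C_1(\alpha)}\left(\frac{\gamma_1^2}{\varepsilon}+\frac{8\varepsilon}{c^2}\right)^{1/2},\quad\hat\rho_0'=2\hat\rho_0,\quad C_2(r)=C_0(\alpha)+\frac{(\hat\rho_0')^2}{2r},\quad\hat\rho_1=\left(\frac2\varepsilon C_1(\alpha)+\frac{(\hat\rho_0')^2}{r\varepsilon}\right)^{1/2}.$$ Consider a time mesh with $$k=\sup_{n\ge0}k_n<\frac{2\varepsilon}{c^2},$$ and let $n_0$ be a positive integer with $t^{n_0}\ge\left(\frac{\gamma_1^2}{\varepsilon}+\frac{8\varepsilon}{c^2}\right)\ln(R^2/\hat\rho_0^2)$.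 Let $\{u^n\}_{n\ge0}$ be a solution of the implicit Euler scheme $$\bar\partial_tu^{n+1}+A\omega^{n+1}=0,\qquad\omega^{n+1}=\varepsilon Au^{n+1}+f(u^{n+1}),\qquad n\ge0,\qquad u^0=u_0,$$ where $|u_0|_2\le R_2$, $|\overline{u_0}|_{-1}\le R$ and $|m(u_0)|\le\alpha$. Let $\gamma_6,\gamma_7>0$ be constants such that $|u^n|_3\le\gamma_6|\varepsilon\Delta u^n|_1$ and $|f(u^n)|_1\le\gamma_7|u^n|_1$ for all $n\ge1$. Then there exist positive integers $n_1$, $N_1$, $n_\omega$ with $t^{n_0+N_1}-t^{n_0}\ge r$ and $r_1:=t^{n_\omega}-t^{n_0+N_1}>0$ such that, setting $$\rho_\omega^2:=\left(\frac{c^2}{4\varepsilon}C_1(\alpha)+\frac{c^2(\hat\rho_0')^2}{8\varepsilon r_1}+\frac{C_2(r)}{r_1}\right)\exp\left(\frac{2c^2r_1}{\varepsilon}\right),$$ one has $|u^n|_1\le\hat\rho_1$ for $n\ge n_1$, $|\omega^n|_1\le\rho_\omega$ for $n\ge n_\omega$, and $$|u^n|_3\le\hat\rho_3,\qquad n\ge n_3:=\max\{n_\omega,n_1\},$$ with $\hat\rho_3=\gamma_6\rho_\omega+\gamma_6\gamma_7\hat\rho_1$.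
   Context: Let $d\in\{1,2,3\}$. Either $\Omega\subset\mathbb R^d$ is a bounded domain with sufficiently smooth boundary (Neumann case), or $\Omega=(0,L)^d$ (periodic case). $H=L^2(\Omega)$ has inner product $(\cdot,\cdot)$ and norm $\|\cdot\|$. $A=-\Delta$ with domain $\mathcal D(A)=\{v\in H^2(\Omega):\partial v/\partial\nu=0 \text{ on }\partial\Omega\}$ in the Neumann case, and the $L$-periodic (in each coordinate) $H^2$ functions in the periodic case. For $s\ge0$, $\dot H^s=\mathcal D(A^{s/2})$ and $|v|_s=\|A^{s/2}v\|$ (so $|v|_1=\|\nabla v\|$, $|v|_2=\|\Delta v\|$, $|v|_3=\|\nabla\Delta v\|$). For $v\in L^1(\Omega)$, $m(v)=|\Omega|^{-1}\int_\Omega v\,dx$ and $\bar v=v-m(v)$. $G$ denotes the inverse of $A$ acting on functions with zero average, and $|v|_{-1}=\|G^{1/2}v\|$ for $v$ with zero average. $\gamma_1>0$ is a constant depending only on $\Omega$ such that $|v-m(v)|_{-1}\le\gamma_1|v|_1$ for all $v\in H^1$. Time mesh: $0=t^0<t^1<\cdots<t^n<\cdots$ is a partition of $[0,\infty)$ (so $t^n\to\infty$), $k_n=t^{n+1}-t^n$, $k=\sup_nk_n$, and $\bar\partial_tv^{n+1}=(v^{n+1}-v^n)/k_n$. The initial value satisfies $u_0\in\dot H^2$. Solutions are understood to be sufficiently regular: $u^{n+1}\in\dot H^3$, $\omega^{n+1}\in\mathcal D(A)$ and the equations hold in $L^2(\Omega)$ for all $n\ge0$. $\omega^{n+1}$ is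 called the discrete chemical potential. In the paper the inequality with $\gamma_7$ is taken from the literature. *)

(* Defs.v *)
From HB Require Import structures.
From mathcomp Require Import all_boot all_order all_algebra.
From mathcomp Require Import all_classical all_reals all_analysis.
From mathcomp Require Import measurable_realfun.

Set Implicit Arguments.
Unset Strict Implicit.
Unset Printing Implicit Defensive.
Import Order.TTheory GRing.Theory Num.Theory.
Import numFieldNormedType.Exports.
Local Open Scope classical_set_scope.
Local Open Scope ring_scope.

Section BorelRow.
Context (R : realType) (d : nat).

Let rV_set0 : <<s @open 'rV[R]_d >> set0.
Proof. exact: sigma_algebra0. Qed.
Let rV_setC A : <<s @open 'rV[R]_d >> A -> <<s @open 'rV[R]_d >> (~` A).
Proof. exact: sigma_algebraC. Qed.
Let rV_bigcup (F : (set 'rV[R]_d)^nat) : (forall i, <<s @open 'rV[R]_d >> (F i)) ->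
  <<s @open 'rV[R]_d >> (\bigcup_i (F i)).
Proof. exact: sigma_algebra_bigcup. Qed.

HB.instance Definition _ := @isMeasurable.Build (sigma_display (@open 'rV[R]_d))
  'rV[R]_d <<s @open 'rV[R]_d >> rV_set0 rV_setC rV_bigcup.

End BorelRow.

Lemma product_measure_sigma_finiteT d1 d2 (T1 : measurableType d1)
  (T2 : measurableType d2) (R : realType)
  (m1 : {sigma_finite_measure set T1 -> \bar R})
  (m2 : {sigma_finite_measure set T2 -> \bar R}) :
  sigma_finite setT (m1 \x m2)%E.
Proof.
have /sigma_finiteP[F [TF ndF Foo]] := sigma_finiteT m1.
have /sigma_finiteP[G [TG ndG Goo]] := sigma_finiteT m2.
exists (fun n => F n `*` G n).
  rewrite -setXTT TF TG predeqE => -[x y]; split.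
    move=> [/= [n _ Fnx] [k _ Gky]]; exists (maxn n k) => //; split.
    - by move: x Fnx; exact/subsetPset/ndF/leq_maxl.
    - by move: y Gky; exact/subsetPset/ndG/leq_maxr.
  by move=> [n _ []/= ? ?]; split; exists n.
move=> k; have [? ?] := Foo k; have [? ?] := Goo k.
split; first exact: measurableX.
by rewrite product_measure1E// lte_mul_pinfty// ge0_fin_numE.
Qed.

Section LebesgueTuple.
Context (R : realType).

Definition tcons n (xt : measurableTypeR R * n.-tuple (measurableTypeR R)) :
  n.+1.-tuple (measurableTypeR R) := [tuple of xt.1 :: xt.2].

Lemma measurable_tcons n : measurable_fun setT (@tcons n).
Proof. exact: measurable_cons. Qed.

Section step.
Context (n : nat)
  (mu : {sigma_finite_measure set (n.-tuple (measurableTypeR R)) -> \bar R}).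



Definition leb_step : set (n.+1.-tuple (measurableTypeR R)) -> \bar R :=
  pushforward (@lebesgue_measure R \x mu)%E (@tcons n).

Let leb_step0 : leb_step set0 = 0%E.
Proof. by rewrite /leb_step /pushforward preimage_set0 measure0. Qed.

Let leb_step_ge0 A : (0 <= leb_step A)%E.
Proof. exact: (measure_ge0 (@lebesgue_measure R \x mu)%E). Qed.

Let leb_step_sigma_additive : semi_sigma_additive leb_step.
Proof.
exact: (@measure_semi_sigma_additive _ _ _
  (measure_function_pushforward__canonical__measure_function_Measure
     (@lebesgue_measure R \x mu)%E (measurable_tcons (n:=n)))).
Qed.

HB.instance Definition _ := isMeasure.Build _ _ _ leb_step
  leb_step0 leb_step_ge0 leb_step_sigma_additive.

Let leb_step_sigma_finite : sigma_finite setT leb_step.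
Proof.
have [F TF Foo] : sigma_finite setT (@lebesgue_measure R \x mu)%E.
  exact: product_measure_sigma_finiteT.
pose h (t : n.+1.-tuple (measurableTypeR R)) : measurableTypeR R * n.-tuple (measurableTypeR R)
  := (thead t, [tuple of behead t]).
have mh : measurable_fun setT h.
  by apply/measurable_fun_pairP; split; [exact: measurable_tnth|exact: measurable_behead].
have hK : cancel (@tcons n) h.
  by move=> [x t]; congr pair => //; exact/val_inj.
exists (fun k => h @^-1` F k).
  by rewrite -preimage_bigcup -TF preimage_setT.
move=> k; have [mF Fk] := Foo k; split.
  by rewrite -[X in measurable X]setTI; exact: mh.
rewrite /leb_step /pushforward -comp_preimage (_ : h \o @tcons n = id) //.
by apply/funext => x /=; rewrite hK.
Qed.

HB.instance Definition _ := @Measure_isSigmaFinite.Build _ _ _ leb_step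
  leb_step_sigma_finite.
End step.
Arguments leb_step {n} mu.

Fixpoint leb_tuple (n : nat) :
    {sigma_finite_measure set (n.-tuple (measurableTypeR R)) -> \bar R} :=
  match n with
  | 0 => \d_ ([tuple] : 0.-tuple (measurableTypeR R))
  | n'.+1 => leb_step (leb_tuple n')
  end.

End LebesgueTuple.

Section LebesgueRow.
Context (R : realType) (d : nat).

Definition row_of_tuple (t : d.-tuple (measurableTypeR R)) : 'rV[R]_d :=
  \row_i tnth t i.

(* An open set is the union of the sup-norm balls of rational centre and radius
   it contains. *)
Lemma measurable_row_of_tuple : measurable_fun setT row_of_tuple.
Proof.
apply: (measurability (@open 'rV[R]_d)) => //.
move=> _ [U oU <-]; rewrite setTI.
pose q (c : 'rV[rat]_d) : 'rV[R]_d := map_mx ratr c.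
pose B (z : 'rV[rat]_d * nat) : set (d.-tuple (measurableTypeR R)) :=
  if `[< ball (q z.1) (z.2.+1%:R^-1 : R) `<=` U >]
  then row_of_tuple @^-1` ball (q z.1) (z.2.+1%:R^-1 : R) else set0.
have -> : row_of_tuple @^-1` U = \bigcup_z B z.
  apply/seteqP; split => [t /= Ut|t [z _]]; last first.
    by rewrite /B; case: asboolP => // zU /zU.
  have /nbhs_ballP[e /= e0 eU] : nbhs (row_of_tuple t) U by exact: open_nbhs_nbhs.
  have [n ne] : exists n : nat, n.+1%:R^-1 < e / 2.
    have e20 : 0 < e / 2 by rewrite divr_gt0.
    exists (Num.truncn (e / 2)^-1).
    by rewrite invf_plt ?posrE// truncnS_gt.
  have rat_near (x : R) : exists c : rat, `|x - ratr c| < n.+1%:R^-1.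
    have n0 : (0 : R) < n.+1%:R^-1 by rewrite invr_gt0.
    have /rat_in_itvoo[c] : x - n.+1%:R^-1 < x + n.+1%:R^-1 by rewrite ltrD2l gtrN.
    rewrite in_itv/= => /andP[c1 c2]; exists c.
    by rewrite ltr_distlC c1 c2.
  have [c cP] := choice (fun i => rat_near (tnth t i)).
  pose z : 'rV[rat]_d * nat := (\row_i c i, n).
  have zt : ball (q z.1) (z.2.+1%:R^-1 : R) (row_of_tuple t).
    split => /=; first by rewrite invr_gt0.
    by move=> i j; rewrite /q !mxE -ball_normE/= distrC; exact: cP.
  exists z => //; rewrite /B; case: asboolP => //= -[].
  move=> y zy; apply: eU.
  apply: (@le_ball _ _ _ (n.+1%:R^-1 + n.+1%:R^-1)).
    by rewrite [leRHS]splitr lerD// ltW.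
  by apply: ball_triangle zy; exact: ball_sym.
apply: countable_bigcupT_measurable => // z; rewrite /B; case: ifP => // _.
rewrite (_ : _ @^-1` _ = \bigcap_(i in [set: 'I_d])
    (fun t => tnth t i) @^-1` ball (q z.1 ord0 i) (z.2.+1%:R^-1 : R)).
  apply: fin_bigcap_measurable => // i _.
  rewrite -[X in measurable X]setTI; apply: measurable_tnth => //.
  exact: measurable_ball.
apply/seteqP; split => t /=.
  move=> zt i _; have [_ /(_ ord0 i)] : ball (q z.1) (z.2.+1%:R^-1 : R) (row_of_tuple t) := zt.
  by rewrite [row_of_tuple _ _ _]mxE.
move=> zt; split => [|i j]; first by rewrite invr_gt0.
by rewrite ord1 [row_of_tuple _ _ _]mxE; exact: (zt j I).
Qed.

Definition lebesgue_rV : set 'rV[R]_d -> \bar R :=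
  pushforward (leb_tuple R d) row_of_tuple.

Let lebesgue_rV0 : lebesgue_rV set0 = 0%E.
Proof. by rewrite /lebesgue_rV /pushforward preimage_set0 measure0. Qed.

Let lebesgue_rV_ge0 A : (0 <= lebesgue_rV A)%E.
Proof. exact: (measure_ge0 (leb_tuple R d)). Qed.

Let lebesgue_rV_sigma_additive : semi_sigma_additive lebesgue_rV.
Proof.
exact: (@measure_semi_sigma_additive _ _ _
  (measure_function_pushforward__canonical__measure_function_Measure
     (leb_tuple R d) measurable_row_of_tuple)).
Qed.

HB.instance Definition _ := isMeasure.Build _ _ _ lebesgue_rV
  lebesgue_rV0 lebesgue_rV_ge0 lebesgue_rV_sigma_additive.

End LebesgueRow.

Section Sobolev.
Context (R : realType) (d : nat).
Local Notation E := 'rV[R]_d.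
Local Notation leb := (@lebesgue_rV R d).

Definition unit_rV (i : 'I_d) : E := delta_mx ord0 i.

Fixpoint Ck (k : nat) (phi : E -> R) : Prop :=
  continuous phi /\
  match k with
  | 0 => True
  | k'.+1 => forall i, (forall x, derivable phi x (unit_rV i)) /\
                       Ck k' (fun x => 'D_(unit_rV i) phi x)
  end.

Definition test_function (U : set E) (phi : E -> R) : Prop :=
  (forall k, Ck k phi) /\
  exists K : set E, [/\ compact K, K `<=` U & forall x, ~ K x -> phi x = 0].

Definition L2 (U : set E) (v : E -> R) : Prop :=
  measurable_fun U v /\ (\int[leb]_(x in U) (v x ^+ 2)%:E < +oo)%E.

Definition L2loc (v : E -> R) : Prop := forall K : set E, compact K -> L2 K v.

Definition weak_partial (U : set E) (i : 'I_d) (v g : E -> R) : Prop :=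
  forall phi, test_function U phi ->
    \int[leb]_(x in U) (v x * 'D_(unit_rV i) phi x)
    = - \int[leb]_(x in U) (g x * phi x).

(* [P] is the integrability class: [L2 U] gives H^1(U) and H^2(U), while [L2loc]
   with [U = setT] gives their local versions on the whole space. *)
Definition is_H1 (P : (E -> R) -> Prop) (U : set E) (v : E -> R)
    (g : 'I_d -> E -> R) : Prop :=
  P v /\ forall i, P (g i) /\ weak_partial U i v (g i).

Definition is_H2 (P : (E -> R) -> Prop) (U : set E) (v : E -> R)
    (g : 'I_d -> E -> R) (h : 'I_d -> 'I_d -> E -> R) : Prop :=
  is_H1 P U v g /\ forall i, is_H1 P U (g i) (h i).

(* The normal trace of the H(div) field [g = grad v] is the functional
   phi |-> \int (Delta v phi + grad v . grad phi) on H^1(U). *)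
Definition zero_normal_derivative (U : set E) (g : 'I_d -> E -> R)
    (h : 'I_d -> 'I_d -> E -> R) : Prop :=
  forall phi q, is_H1 (L2 U) U phi q ->
    \int[leb]_(x in U) ((\sum_i h i i x) * phi x + \sum_i g i x * q i x) = 0.

(* Class C^2 suffices, by elliptic regularity, for the Laplacian to be self-adjoint
   on {v in H^2 : dv/dnu = 0}. *)
Definition C2_boundary (U : set E) : Prop :=
  forall x, closure U x -> ~ U x ->
    exists (N : set E) (psi : E -> R),
      [/\ open N, N x, Ck 2 psi, (exists i, 'D_(unit_rV i) psi x != 0)
        & forall y, N y -> (U y <-> psi y < 0)].

End Sobolev.

Inductive setting (R : realType) (d : nat) : Type :=
  | Neumann of set 'rV[R]_d
  | Periodic of R.

Section Operators.
Context (R : realType) (d : nat).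
Local Notation E := 'rV[R]_d.
Local Notation leb := (@lebesgue_rV R d).

Definition dom (s : setting R d) : set E :=
  match s with
  | Neumann Om => Om
  | Periodic L => [set x | forall i, 0 < x ord0 i < L]
  end.

Definition admissible (s : setting R d) : Prop :=
  match s with
  | Neumann Om =>
      [/\ Om !=set0, open Om, connected Om, bounded_set Om & C2_boundary Om]
  | Periodic L => 0 < L
  end.

Definition ae_equal (s : setting R d) (v w : E -> R) : Prop :=
  {ae leb, forall x, dom s x -> v x = w x}.

Definition periodic (L : R) (v : E -> R) : Prop :=
  forall x i, v (x + L *: unit_rV R i) = v x.

(* Unbounded operators are represented by their graphs; functions matter only
   through their values almost everywhere in the domain. *)
Definition operator := set ((E -> R) * (E -> R)).

(* The domain, including the boundary condition, is part of the graph. *)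
Definition laplacian (s : setting R d) : operator :=
  [set vw | L2 (dom s) vw.2 /\
    match s with
    | Neumann Om => exists g h,
        [/\ is_H2 (L2 Om) Om vw.1 g h, zero_normal_derivative Om g h
          & ae_equal s vw.2 (fun x => \sum_i h i i x)]
    | Periodic L => exists v g h,
        [/\ periodic L v, (forall x, dom s x -> v x = vw.1 x),
            is_H2 (@L2loc R d) setT v g h
          & ae_equal s vw.2 (fun x => \sum_i h i i x)]
    end].

Definition opA (s : setting R d) : operator :=
  [set vw | laplacian s (vw.1, \- vw.2)].

Definition inner (s : setting R d) (v w : E -> R) : R :=
  \int[leb]_(x in dom s) (v x * w x).

Definition norm2 (s : setting R d) (v : E -> R) : R := Num.sqrt (inner s v v).

Definition vol (s : setting R d) : R := fine (leb (dom s)).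

Definition mean (s : setting R d) (v : E -> R) : R :=
  (vol s)^-1 * \int[leb]_(x in dom s) v x.

Definition centered (s : setting R d) (v : E -> R) : E -> R :=
  fun x => v x - mean s v.

(* [S] is the nonnegative self-adjoint square root of [T] in the Hilbert space
   [K], a closed subspace of L^2; a square root with these properties is unique. *)
Definition is_sqrt_op (s : setting R d) (K : set (E -> R)) (T S : operator) : Prop :=
  [/\ (forall v w, S (v, w) -> K v /\ K w),
      (forall v e, K v -> 0 < e ->
         exists x y, S (x, y) /\ norm2 s (v \- x) < e),
      (forall v w, K v -> K w ->
         (S (v, w) <-> forall x y, S (x, y) -> inner s v y = inner s w x)),
      (forall v w, S (v, w) -> 0 <= inner s w v)
    & (forall v w, T (v, w) <-> exists z, S (v, z) /\ S (z, w))].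

Definition sqrt_op (s : setting R d) (K : set (E -> R)) (T : operator) : operator :=
  xget set0 [set S | is_sqrt_op s K T S].

(* [|T v|], with value +oo when [v] is not in the domain of [T]. *)
Definition op_norm (s : setting R d) (T : operator) (v : E -> R) : \bar R :=
  ereal_inf [set (norm2 s w)%:E | w in [set w | T (v, w)]].

(* A^(m/2), the [m]-th power of A^(1/2). *)
Fixpoint powA (s : setting R d) (m : nat) : operator :=
  match m with
  | 0 => [set vw | [/\ L2 (dom s) vw.1, L2 (dom s) vw.2 & ae_equal s vw.1 vw.2]]
  | m'.+1 => [set vw | exists z, sqrt_op s (L2 (dom s)) (opA s) (vw.1, z) /\
                                 powA s m' (z, vw.2)]
  end.

Definition Hdot (s : setting R d) (m : nat) (v : E -> R) : Prop :=
  exists w, powA s m (v, w).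

Definition Hnorm (s : setting R d) (m : nat) (v : E -> R) : \bar R :=
  op_norm s (powA s m) v.

Definition L2_zero_mean (s : setting R d) : set (E -> R) :=
  [set v | L2 (dom s) v /\ mean s v = 0].

Definition opG (s : setting R d) : operator :=
  [set vw | [/\ L2_zero_mean s vw.1, L2_zero_mean s vw.2 & opA s (vw.2, vw.1)]].

Definition Hnorm_m1 (s : setting R d) (v : E -> R) : \bar R :=
  op_norm s (sqrt_op s (L2_zero_mean s) (opG s)) v.

End Operators.

Section Scheme.
Context (R : realType) (d : nat).
Local Notation E := 'rV[R]_d.

Definition time_mesh (t : nat -> R) : Prop :=
  [/\ t 0%N = 0, (forall n, t n < t n.+1) & t n @[n --> \oo] --> +oo].

Definition step (t : nat -> R) (n : nat) : R := t n.+1 - t n.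

(* The chemical potential [omega n] is meaningful for n >= 1 only. *)
Definition implicit_euler_solution (s : setting R d) (eps : R) (f : R -> R)
    (t : nat -> R) (u0 : E -> R) (u omega : nat -> E -> R) : Prop :=
  u 0%N = u0 /\
  forall n, Hdot s 3 (u n.+1) /\
    exists Au Aomega,
      [/\ opA s (u n.+1, Au), opA s (omega n.+1, Aomega),
          ae_equal s (fun x => (u n.+1 x - u n x) / step t n + Aomega x) (cst 0)
        & ae_equal s (omega n.+1) (fun x => eps * Au x + f (u n.+1 x))].

End Scheme.

(* Main.v *)
Require Import Defs.
From mathcomp Require Import all_boot all_order all_algebra.
From mathcomp Require Import all_classical all_reals all_analysis.
From mathcomp Require Import measurable_realfun ring lra.

(* With B = A^(1/2) and J(u) = eps/2 |u|_1^2 + \int F(u), testing the scheme with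
   G(u - m(u)) gives
     |u'|_{-1}^2 - |u|_{-1}^2 <= 2 k (C_0 - eps |u'|_1^2 - \int F(u')),
   hence an absorbing ball in the (-1)-norm and, after averaging over a time interval
   of length r, a bound for J, which is nonincreasing:
     J(u') + 3/4 k |omega'|_1^2 <= J(u)   as   k < 2 eps / c^2.
   This bounds |u^n|_1.  Testing the difference of two consecutive potentials gives
     |omega'|_1^2 - |omega|_1^2 <= c^2/(2 eps) k |omega'|_1^2,
   so |omega|_1^2 + 2 c^2/(3 eps) J is nonincreasing as well.  As J is bounded below,
   k |omega'|_1^2 is summable, and therefore |omega^n|_1 -> 0; since rho_omega^2 is at
   least c^2 C_1 / (4 eps) > 0 whatever r_1 is, n_omega may be taken large.  The bound in
   H^3 follows from -eps Delta u = omega - f(u).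

   In the formal setting the self-adjointness of the Laplacian is never needed: the
   regularity of the solution is only meaningful if A^(1/2) exists.  What remains to be
   checked about the Laplacian is A 1 = 0, i.e. that derivatives of test functions
   integrate to zero. *)

Set Implicit Arguments.
Unset Strict Implicit.
Unset Printing Implicit Defensive.
Import Order.TTheory GRing.Theory Num.Theory.
Import numFieldNormedType.Exports.
Local Open Scope classical_set_scope.
Local Open Scope ring_scope.

(** * Translation invariance of Lebesgue measure *)

Section Translation.
Context (R : realType).

(** The image of Lebesgue measure under a translation agrees with it on the intervals []a, b]], so
    uniqueness of Lebesgue measure applies. *)
Lemma lebesgue_measure_shift (h : R) (A : set (measurableTypeR R)) :
  measurable A -> lebesgue_measure ((fun x => x + h) @^-1` A) = lebesgue_measure A.
Proof.
have msh : measurable_fun setT (fun x : measurableTypeR R => (x + h : measurableTypeR R)).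
  exact: measurable_funD.
move=> mA; apply/esym; have := @lebesgue_measure_unique R
  (measure_function_pushforward__canonical__measure_function_Measure
     (@lebesgue_measure R) msh).
move=> /(_ _ A mA) -> // X [[a b]] /= ab <-; rewrite /pushforward.
rewrite (_ : _ @^-1` _ = `]a - h, b - h]%classic).
  rewrite !lebesgue_measure_itv /= !lte_fin ltrD2r -!EFinD.
  by congr (if _ then _ else _); congr (_%:E); ring.
by apply/seteqP; split => x /=; rewrite !in_itv /= ltrBlDr lerBrDr.
Qed.

Definition tuple_add n (a t : n.-tuple (measurableTypeR R)) : n.-tuple (measurableTypeR R) :=
  [tuple tnth t i + tnth a i | i < n].

Lemma tuple_add_tcons n (a : n.+1.-tuple (measurableTypeR R)) x t :
  tuple_add a (tcons (x, t)) = tcons (x + thead a, tuple_add [tuple of behead a] t).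
Proof.
apply: eq_from_tnth => i; rewrite tnth_mktuple.
case: (unliftP ord0 i) => [j|] ->.
  rewrite !tnthS tnth_mktuple; congr (_ + _).
  by rewrite [in LHS](tuple_eta a) tnthS.
by rewrite !tnth0.
Qed.

(** Induction on the dimension by slicing along the first coordinate. The induction hypothesis
    shifts each slice, and the remaining integral over the first coordinate is invariant by the
    one-dimensional case. *)
Lemma leb_tuple_shift n (a : n.-tuple (measurableTypeR R)) A : measurable A ->
  leb_tuple R n (tuple_add a @^-1` A) = leb_tuple R n A.
Proof.
elim: n a A => [|n IH] a A mA.
  congr (leb_tuple R 0 _); apply/seteqP; split => t /=.
    by rewrite (tuple0 (tuple_add a t)) (tuple0 t).
  by rewrite (tuple0 (tuple_add a t)) (tuple0 t).
rewrite /= /leb_step /pushforward /product_measure1.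
have mB : measurable (@tcons R n @^-1` A).
  by rewrite -[X in measurable X]setTI; exact: measurable_tcons.
set B := _ @^-1` A in mB *.
pose g x := leb_tuple R n (xsection B x).
have mg : measurable_fun setT g by exact: measurable_fun_xsection.
have -> : (\int[lebesgue_measure]_x
    (leb_tuple R n \o xsection (@tcons R n @^-1` (tuple_add a @^-1` A))) x
  = \int[lebesgue_measure]_x (g \o (fun x => x + thead a)%R) x)%E.
  apply: eq_integral => x _ /=; rewrite /g -(IH [tuple of behead a]).
    congr (leb_tuple R n _); apply/seteqP; split => t /=; rewrite /xsection /= !inE /B /=.
      by rewrite tuple_add_tcons.
    by rewrite tuple_add_tcons.
  exact: measurable_xsection.
have msh : measurable_fun setT (fun x : measurableTypeR R => (x + thead a : measurableTypeR R)).
  exact: measurable_funD.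
rewrite -(preimage_setT (fun x : measurableTypeR R => x + thead a)).
rewrite -(ge0_integral_pushforward msh) //.
apply: eq_measure_integral => X mX _.
by rewrite -[RHS](lebesgue_measure_shift (thead a)).
Qed.
End Translation.

(** * Borel sets and translations of row vectors *)

Section Row.
Context (R : realType) (d : nat).
Local Notation E := 'rV[R]_d.
Local Notation leb := (@lebesgue_rV R d).

Lemma open_measurable_rV (U : set E) : open U -> measurable U.
Proof. exact: sub_sigma_algebra. Qed.

Lemma continuous_measurable_rV (f : E -> R) : continuous f -> measurable_fun setT f.
Proof.
move=> /continuousP cf; apply: (measurability _ (RGenOpens.measurableE R)).
move=> _ [_ [a [b ->] <-]]; rewrite setTI; apply: open_measurable_rV.
exact/cf/interval_open.
Qed.

Lemma continuous_addr_rV (a : E) : continuous (fun x : E => x + a).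
Proof. by move=> x; apply: continuousD; [exact: cvg_id|exact: cst_continuous]. Qed.

Lemma measurable_addr_rV (a : E) : measurable_fun setT (fun x : E => x + a).
Proof.
apply: (measurability (@open E)) => //.
move=> _ [U oU <-]; rewrite setTI; apply: open_measurable_rV.
by apply: open_comp => // x _; exact: continuous_addr_rV.
Qed.

Lemma lebesgue_rV_shift (a : E) (A : set E) : measurable A ->
  leb ((fun x => x + a) @^-1` A) = leb A.
Proof.
move=> mA; rewrite /lebesgue_rV /pushforward.
rewrite -[RHS](leb_tuple_shift [tuple a ord0 i | i < d]); last first.
  by rewrite -[X in measurable X]setTI; exact: measurable_row_of_tuple.
congr (leb_tuple R d _); apply/seteqP.
have H t : row_of_tuple (tuple_add [tuple a ord0 i | i < d] t) = row_of_tuple t + a.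
  by apply/rowP => i; rewrite !mxE !tnth_mktuple.
by split => t /=; rewrite H.
Qed.

Lemma integral_rV_shift (a : E) (f : E -> \bar R) :
  measurable_fun setT f -> leb.-integrable setT (f \o (fun x => x + a)) ->
  (\int[leb]_x f (x + a)%R = \int[leb]_x f x)%E.
Proof.
move=> mf intf.
have := @integral_pushforward _ _ E E R _ (measurable_addr_rV a) leb setT f mf.
rewrite preimage_setT => /(_ intf measurableT) /= <-.
apply: eq_measure_integral; first exact: measurable_addr_rV.
by move=> ? X mX _; exact: lebesgue_rV_shift.
Qed.

End Row.

(** * Measure of balls, bounded sets and open sets *)

Section Ball.
Context (R : realType).

(** Balls of the sup norm are cubes, so this is the volume of a centred ball, computed one factor at
    a time. *)
Lemma leb_tuple_cube n (e : R) : 0 < e ->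
  leb_tuple R n [set t | forall i, `|tnth t i| < e] = ((2 * e) ^+ n)%:E.
Proof.
move=> e0; elim: n => [|n IH].
  rewrite expr0 /= diracE mem_set //= => -[] //.
rewrite /= /leb_step /pushforward.
have -> : @tcons R n @^-1` [set t | forall i, `|tnth t i| < e] =
    `](- e), e[%classic `*` [set t | forall i, `|tnth t i| < e].
  apply/seteqP; split => -[x t] /=.
    move=> H; split; first by have := H ord0; rewrite tnth0 ltr_norml in_itv.
    by move=> i; have := H (lift ord0 i); rewrite tnthS.
  rewrite in_itv /= => -[xe H] i; case: (unliftP ord0 i) => [j|] ->.
    by rewrite tnthS.
  by rewrite tnth0 ltr_norml.
rewrite product_measure1E //; last first.
  rewrite (_ : [set _ | _] = \bigcap_(i in [set: 'I_n])
      (fun t => tnth t i) @^-1` `](- e), e[%classic).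
    apply: fin_bigcap_measurable => // i _.
    by rewrite -[X in measurable X]setTI; exact: measurable_tnth.
  apply/seteqP; split => t /= H i; first by move=> _; rewrite /= in_itv /= -ltr_norml.
  by have := H i I; rewrite /= in_itv /= -ltr_norml.
rewrite IH exprS EFinM; congr (_ * _)%E.
transitivity (@lebesgue_measure R `](- e), e[%classic); first by [].
rewrite lebesgue_measure_itv /= lte_fin gtrN // -EFinD; congr (_%:E); ring.
Qed.

Context (d : nat).
Local Notation E := 'rV[R]_d.
Local Notation leb := (@lebesgue_rV R d).

Lemma measurable_ball_rV (c : E) (e : R) : measurable (ball c e).
Proof. by apply: open_measurable_rV; exact: ball_open. Qed.

Lemma lebesgue_rV_ball (c : E) (e : R) : 0 < e -> leb (ball c e) = ((2 * e) ^+ d)%:E.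
Proof.
move=> e0; rewrite -(lebesgue_rV_shift c); last exact: measurable_ball_rV.
rewrite -leb_tuple_cube // /lebesgue_rV /pushforward; congr (leb_tuple R d _).
apply/seteqP; split => t /=.
  move=> [_ H] i; have := H ord0 i.
  by rewrite -ball_normE /= !mxE opprD addrCA subrr addr0 normrN.
move=> H; split => // i j; rewrite -ball_normE /= !mxE !ord1 opprD addrCA subrr addr0 normrN.
exact: H.
Qed.

Lemma lebesgue_rV_bounded (A : set E) : measurable A -> bounded_set A -> (leb A < +oo)%E.
Proof.
move=> mA [M [_ HM]].
have e0 : 0 < `|M| + 2 by have := normr_ge0 M; lra.
apply: (@le_lt_trans _ _ (leb (ball (0 : E) (`|M| + 2)))).
  apply: le_measure; rewrite ?inE //; first exact: measurable_ball_rV.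
  move=> x Ax; rewrite -ball_normE /= sub0r normrN.
  apply: (@le_lt_trans _ _ (`|M| + 1)); last by rewrite ltrD2l ltr1n.
  by apply: (HM (`|M| + 1)) => //; rewrite (le_lt_trans (ler_norm M)) // ltrDl.
by rewrite lebesgue_rV_ball // ltry.
Qed.

Lemma lebesgue_rV_open_gt0 (A : set E) : open A -> A !=set0 -> (0 < leb A)%E.
Proof.
move=> oA [x Ax].
have /nbhs_ballP[e /= e0 eA] : nbhs x A by exact: open_nbhs_nbhs.
apply: (@lt_le_trans _ _ (leb (ball x e))).
  by rewrite lebesgue_rV_ball // lte_fin exprn_gt0 // mulr_gt0.
by apply: le_measure; rewrite ?inE //; [exact: measurable_ball_rV|exact: open_measurable_rV].
Qed.
End Ball.

(** * Integrals of derivatives of test functions *)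

(** Reduces directional derivatives to derivatives in one real variable, so that the mean value
    theorem becomes available along a line. *)
Lemma is_derive_line (R : realType) (V : normedModType R) (f : V -> R) (x v : V) (t : R) :
  derivable f (t *: v + x) v ->
  is_derive t 1 (fun s : R => f (s *: v + x)) ('D_v f (t *: v + x)).
Proof.
move=> df.
have H : (fun h : R =>
    h^-1 *: (((fun s : R => f (s *: v + x)) \o shift t) (h *: 1) - f (t *: v + x)))
       = (fun h : R => h^-1 *: ((f \o shift (t *: v + x)) (h *: v) - f (t *: v + x))).
  by apply/funext => h /=; rewrite [h *: 1]mulr1 scalerDl addrA.
by apply: DeriveDef; rewrite /derivable /derive H.
Qed.

(** The mean value theorem along the segment from [x]; it later dominates the difference
    quotients. *)
Lemma derive_line_bound (R : realType) (V : normedModType R) (f : V -> R) (v x : V) (M h : R) :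
  (forall y, derivable f y v) -> (forall y, `|'D_v f y| <= M) -> 0 <= h ->
  `|f (h *: v + x) - f x| <= M * h.
Proof.
move=> df fM h0.
have gc : {within `[0, h], continuous (fun s : R => f (s *: v + x))}.
  apply: derivable_within_continuous => s _.
  exact: (@ex_derive _ _ _ _ _ _ _ (is_derive_line (df _))).
have [t _] := @MVT_segment R (fun s : R => f (s *: v + x)) (fun s => 'D_v f (s *: v + x)) 0 h h0
  (fun s _ => is_derive_line (df _)) gc.
rewrite scale0r add0r subr0 => ->.
by rewrite normrM (ger0_norm h0) ler_wpM2r.
Qed.

Section Divergence.
Context (R : realType) (d : nat).
Local Notation E := 'rV[R]_d.
Local Notation leb := (@lebesgue_rV R d).

(** The complement of a compact set is open, so [f] vanishes in a whole neighbourhood of [x]. *)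
Lemma derive_outside_compact (f : E -> R) (v : E) (K : set E) :
  compact K -> (forall x, ~ K x -> f x = 0) -> forall x, ~ K x -> 'D_v f x = 0.
Proof.
move=> cK fK x nKx; rewrite -(derive_cst (0 : R) x v); apply: near_eq_derive.
have : nbhs x (~` K).
  apply: open_nbhs_nbhs; split => //; apply: closed_openC.
  by apply: compact_closed => //; exact: norm_hausdorff.
by apply: filterS => y /fK.
Qed.

(* Differentiate the translation-invariant quantity \int f (x + h v) at h = 0. *)
Lemma Rintegral_derive_compact_support (f : E -> R) (v : E) (K : set E) :
  continuous f -> (forall x, derivable f x v) -> continuous (fun x => 'D_v f x) ->
  compact K -> (forall x, ~ K x -> f x = 0) ->
  \int[leb]_x 'D_v f x = 0.
Proof.
move=> cf df cD cK fK.
have DK := derive_outside_compact v cK fK.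
have [M M0 fM] : exists2 M : R, 0 <= M & forall x, `|'D_v f x| <= M.
  have [B [_ HB]] : bounded_set ((fun x => 'D_v f x) @` K).
    apply: compact_bounded; apply: continuous_compact => //.
    exact: continuous_subspaceT.
  exists (`|B| + 1) => [|x]; first by rewrite addr_ge0.
  have [Kx|nKx] := pselect (K x); last by rewrite DK // normr0 addr_ge0.
  by apply: (HB (`|B| + 1)); [rewrite (le_lt_trans (ler_norm B)) // ltrDl|exists x].
have [r r0 Kr] : exists2 r : R, 0 < r & forall x, K x -> `|x| <= r.
  have [B [_ HB]] := compact_bounded cK.
  exists (`|B| + 1) => [|x Kx]; first by have := normr_ge0 B; lra.
  by apply: (HB (`|B| + 1)) => //; rewrite (le_lt_trans (ler_norm B)) // ltrDl.
(* The margin [|v|] makes one ball contain the supports of all translates by [h v] with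
   [0 < h <= 1]. *)
pose rr := r + `|v| + 1.
have rr0 : 0 < rr by rewrite /rr; have := normr_ge0 v; lra.
pose b : set E := ball (0 : E) rr.
have mb : measurable b by exact: measurable_ball_rV.
have bfin : (leb b < +oo)%E by rewrite /b lebesgue_rV_ball // ltry.
have bE x : b x = (`|x| < rr) :> Prop by rewrite /b -ball_normE /= sub0r normrN.
pose h n : R := n.+1%:R^-1.
have h0 n : 0 < h n by rewrite /h invr_gt0.
have h1 n : h n <= 1 by rewrite /h invf_le1 // ler1n.
pose f_ n (x : E) : \bar R := ((h n)^-1 * (f (h n *: v + x) - f x))%:E.
have cfs n : continuous (fun x : E => f (h n *: v + x)).
  move=> x; apply: (@continuous_comp _ _ _ (fun x : E => h n *: v + x) f); last exact: cf.
  by apply: continuousD; [exact: cst_continuous|exact: cvg_id].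
have mf_ n : measurable_fun setT (f_ n).
  apply/measurable_EFinP; apply: continuous_measurable_rV => x.
  apply: (@continuousM _ _ (cst _) (fun x : E => f (h n *: v + x) - f x)).
    exact: cst_continuous.
  by apply: continuousB; [exact: cfs|exact: cf].
have intb (g : E -> R) : continuous g -> (forall x, ~ b x -> g x = 0) ->
    (exists B : R, forall x, `|g x| <= B) -> leb.-integrable setT (EFin \o g).
  move=> cg g0 [B gB].
  have -> : EFin \o g = (EFin \o g) \_ b.
    apply/funext => x; rewrite patchE; case: ifPn => // /negP xb /=.
    by rewrite g0 // => /mem_set.
  apply/(integrable_mkcond _ mb).1.
  apply: measurable_bounded_integrable => //.
  - by apply: measurable_funTS; exact: continuous_measurable_rV.
  - exists B; split; first exact: num_real.
    by move=> y By x _ /=; exact: le_trans (gB x) (ltW By).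
have supp n x : ~ b x -> f x = 0 /\ f (h n *: v + x) = 0.
  rewrite bE => /negP; rewrite -leNgt /rr => rx.
  split; apply: fK => /Kr.
    by have := normr_ge0 v; lra.
  have : `|x| <= `|h n *: v + x| + `|h n *: v|.
    by rewrite -{1}(addKr (h n *: v) x) addrC; apply: le_trans (ler_normB _ _) _.
  have : `|h n *: v| <= `|v|.
    by rewrite normrZ gtr0_norm // -[leRHS]mul1r ler_wpM2r.
  by lra.
have fB : exists B : R, forall x, `|f x| <= B.
  have [B [_ HB]] : bounded_set (f @` K).
    apply: compact_bounded; apply: continuous_compact => //.
    exact: continuous_subspaceT.
  exists (`|B| + 1) => x.
  have [Kx|nKx] := pselect (K x); last by rewrite fK // normr0 addr_ge0.
  by apply: (HB (`|B| + 1)); [rewrite (le_lt_trans (ler_norm B)) // ltrDl|exists x].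
have intf : leb.-integrable setT (EFin \o f).
  by apply: intb => // x /(supp 0%N)[].
have intfs n : leb.-integrable setT (EFin \o (fun x => f (h n *: v + x))).
  apply: intb => //; first by move=> x /(supp n)[].
  by have [B HB] := fB; exists B.
(* The two terms of the difference quotient have the same integral by translation invariance. *)
have f_0 n : (\int[leb]_x f_ n x = 0)%E.
  rewrite /f_; under eq_integral do rewrite EFinM EFinB.
  rewrite integralZl //; last by apply: integrableB; [|exact: intfs|exact: intf].
  rewrite integralB //; last exact: intfs.
  have -> : (\int[leb]_x (f (h n *: v + x))%:E = \int[leb]_x (f x)%:E)%E.
    rewrite -(@integral_rV_shift R d (h n *: v) (EFin \o f)).
    - by apply: eq_integral => x _ /=; rewrite addrC.
    - by apply/measurable_EFinP; apply: continuous_measurable_rV.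
    - by apply: eq_integrable (intfs n) => // x _ /=; rewrite addrC.
  rewrite subee ?mule0 //.
  exact: integrable_fin_num.
(* The quotients converge pointwise to the derivative and are bounded by [M] on the ball [b],
   outside which they vanish. *)
have [] := @dominated_convergence _ E R leb setT measurableT f_ (fun x => ('D_v f x)%:E)
  (fun x => (M * \1_b x)%:E) mf_.
- by apply/measurable_EFinP; apply: continuous_measurable_rV.
- apply: aeW => x _; apply: cvg_EFin; first by apply: nearW => n.
  have /cvgr_dnbhsP := @ex_derive _ _ _ _ _ _ _ (derivableP (df x)).
  move=> /(_ h) H; apply: H; split => [n|]; first by rewrite gt_eqF.
  exact: cvg_harmonic.
- under eq_fun do rewrite EFinM.
  apply: integrableZl => //.
  rewrite (_ : (fun x => _) = (EFin \o cst 1) \_ b); last first.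
    by apply/funext => x; rewrite patchE indicE; case: ifP.
  apply/(integrable_mkcond _ mb).1; apply: measurable_bounded_integrable => //.
  by exists 1; split; [exact: num_real|move=> y y1 x _ /=; rewrite normr1 ltW].
- apply: aeW => x n _; rewrite /f_ /= lee_fin.
  have [bx|nbx] := pselect (b x).
    rewrite indicE mem_set // mulr1 normrM gtr0_norm ?invr_gt0 //.
    rewrite ler_pdivrMl // mulrC.
    by apply: derive_line_bound => //; exact: ltW.
  have [-> ->] := supp n x nbx.
  by rewrite subrr mulr0 normr0 mulr_ge0 // indicE.
move=> _ _; rewrite (_ : [sequence _]_n = cst 0%E); last by apply/funext => n /=; exact: f_0.
by rewrite /Rintegral => /cvg_lim <- //; rewrite lim_cst.
Qed.

End Divergence.

(** * The domain, and constants in the kernel of A *)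

Section Domain.
Context (R : realType) (d : nat) (s : setting R d) (hs : admissible s).
Local Notation E := 'rV[R]_d.
Local Notation leb := (@lebesgue_rV R d).

Lemma open_dom : open (dom s).
Proof.
case: s hs => [Om []//|L _] /=.
rewrite openE => x Hx.
suff : \forall y \near x, forall i, 0 < (y : E) ord0 i < L by [].
apply: (@filter_forall _ _ (fun i (y : E) => 0 < y ord0 i < L) (nbhs x)) => i.
have /andP[x0 xL] := Hx i.
have : nbhs (x ord0 i) `]0, L[%classic.
  by apply: open_nbhs_nbhs; split; [exact: interval_open|rewrite /= in_itv /= x0 xL].
move=> /(@coord_continuous R 1 d ord0 i x) H.
have {}H : nbhs x [set y : E | y ord0 i \in `]0, L[] by exact: H.
by apply: (@filterS E (nbhs x) _ _ _ _ H) => y /=; rewrite in_itv.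
Qed.

Lemma dom_neq0 : dom s !=set0.
Proof.
case: s hs => [Om []//|L /= L0]; exists (const_mx (L / 2)) => i /=.
by rewrite mxE; lra.
Qed.

Lemma bounded_dom : bounded_set (dom s).
Proof.
case: s hs => [Om []//|L /= L0]; exists L; split; first exact: num_real.
move=> M LM x /= Hx; rewrite [leLHS]mx_normrE; apply/bigmax_leP; split => [|[i j] _ /=].
  exact: ltW (lt_trans L0 LM).
rewrite ord1; have /andP[x0 xL] := Hx j.
by rewrite gtr0_norm // ltW // (lt_trans xL).
Qed.

Lemma measurable_dom : measurable (dom s).
Proof. by apply: open_measurable_rV; exact: open_dom. Qed.

Lemma lebesgue_rV_dom_lty : (leb (dom s) < +oo)%E.
Proof. by apply: lebesgue_rV_bounded; [exact: measurable_dom|exact: bounded_dom]. Qed.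

Lemma vol_gt0 : 0 < vol s.
Proof.
rewrite fine_gt0 // lebesgue_rV_dom_lty lebesgue_rV_open_gt0 //.
  exact: open_dom.
exact: dom_neq0.
Qed.

(** The derivative of a test function vanishes off its support, which lies in [U]; the integral over
    [U] is thus one over the whole space, and it is zero. *)
Lemma weak_partial_cst (U : set E) (i : 'I_d) : measurable U ->
  weak_partial U i (cst 1) (cst 0).
Proof.
move=> mU phi [ck [K [cK KU phiK]]].
have [cphi /(_ i)[dphi [cD _]]] := ck 1%N.
have -> : \int[leb]_(x in U) (cst 0 x * phi x) = 0.
  rewrite (@eq_Rintegral _ _ _ leb U (cst 0)); first by rewrite Rintegral_cst // mul0r.
  by move=> x _ /=; rewrite mul0r.
rewrite oppr0 Rintegral_mkcond.
have DK x : ~ K x -> 'D_(unit_rV R i) phi x = 0.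
  exact: derive_outside_compact.
rewrite (_ : _ \_ U = fun x => 'D_(unit_rV R i) phi x); last first.
  apply/funext => x; rewrite patchE; case: ifPn => [_|/negP xU]; first by rewrite mul1r.
  by rewrite DK // => /KU /mem_set.
exact: (Rintegral_derive_compact_support (K := K)).
Qed.

Lemma measurable_compact_rV (K : set E) : compact K -> measurable K.
Proof.
move=> cK; rewrite -(setCK K); apply: measurableC; apply: open_measurable_rV.
by apply: closed_openC; apply: compact_closed => //; exact: norm_hausdorff.
Qed.

Lemma L2_cst (U : set E) (c : R) : measurable U -> (leb U < +oo)%E -> L2 U (cst c).
Proof.
move=> mU Uoo; split; first exact: measurable_cst.
by rewrite (@integral_cst _ _ _ leb _ mU (c ^+ 2)%:E) lte_mul_pinfty // lee_fin sqr_ge0.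
Qed.

Lemma L2loc_cst (c : R) : L2loc (cst c : E -> R).
Proof.
move=> K cK; apply: L2_cst; first exact: measurable_compact_rV.
by apply: lebesgue_rV_bounded; [exact: measurable_compact_rV|exact: compact_bounded].
Qed.

(** Conservation of the mean and the insensitivity of $|v|_1$ to adding constants both rest on this.
    Zero serves as gradient and Hessian in either setting. *)
Lemma opA_cst1 : opA s (cst 1, cst 0).
Proof.
have e0 : \- (cst 0 : E -> R) = cst 0 by apply/funext => x /=; rewrite oppr0.
have s0 (x : E) : \sum_(i < d) (cst 0 x : R) = 0 by rewrite big1.
have ae0 : ae_equal s (cst 0) (fun x => \sum_(i < d) (cst 0 x : R)).
  by apply: aeW => x _; rewrite s0.
have wp0 U i : measurable U -> weak_partial U i (cst 0 : E -> R) (cst 0).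
  move=> mU phi _.
  have H0 (g : E -> R) : \int[leb]_(x in U) (cst 0 x * g x) = 0.
    rewrite (@eq_Rintegral _ _ _ leb U (cst 0)); first by rewrite Rintegral_cst // mul0r.
    by move=> x _ /=; rewrite mul0r.
  by rewrite !H0 oppr0.
have H2 (P : (E -> R) -> Prop) U : measurable U -> P (cst 1) -> P (cst 0) ->
    is_H2 P U (cst 1) (fun=> cst 0) (fun _ _ => cst 0).
  move=> mU P1 P0; split; first by split => // i; split => //; exact: weak_partial_cst.
  by move=> i; split => // j; split => //; exact: wp0.
have mD := measurable_dom; have Doo := lebesgue_rV_dom_lty.
have L0 := L2_cst 0 mD Doo; have L1 := L2_cst 1 mD Doo.
rewrite /opA /laplacian /= e0; split => //.
case: s L0 L1 mD ae0 => [Om|L] L0 L1 mD ae0.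
  exists (fun=> cst 0), (fun _ _ => cst 0); split => //; first exact: H2.
  move=> phi q _; rewrite (@eq_Rintegral _ _ _ leb Om (cst 0)).
    by rewrite Rintegral_cst // mul0r.
  by move=> x _ /=; rewrite !big1 ?mul0r ?addr0 // => i _; rewrite mul0r.
exists (cst 1), (fun=> cst 0), (fun _ _ => cst 0); split => //.
by apply: H2 => //; exact: L2loc_cst.
Qed.

End Domain.

(** * The inner product of L^2 *)

(** A single form for sums, multiples and differences, so that one lemma on linearity covers all of
    them; [lincomb 1 v (-1) w] is the difference. *)
Definition lincomb (R : realType) (T : Type) (a : R) (v : T -> R) (b : R) (w : T -> R) : T -> R :=
  fun x => a * v x + b * w x.

Section L2.
Context (R : realType) (d : nat) (s : setting R d) (hs : admissible s).
Local Notation E := 'rV[R]_d.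
Local Notation leb := (@lebesgue_rV R d).
Local Notation D := (dom s).
Local Notation LL := (L2 D).

Implicit Types u v w : E -> R.

Let mD : measurable D := measurable_dom hs.
Let Doo : (leb D < +oo)%E := lebesgue_rV_dom_lty hs.

Lemma L2_integrable_sqr v : LL v -> leb.-integrable D (EFin \o (fun x => v x ^+ 2)).
Proof.
move=> [mv vfin]; apply/integrableP; split.
  by apply/measurable_EFinP; exact: measurable_funX.
rewrite (eq_integral (fun x => (v x ^+ 2)%:E)) // => x _ /=.
by rewrite ger0_norm // sqr_ge0.
Qed.

Lemma integrable_sqr_L2 v : measurable_fun D v ->
  leb.-integrable D (EFin \o (fun x => v x ^+ 2)) -> LL v.
Proof.
move=> mv /integrableP[_ vfin]; split => //.
rewrite (eq_integral (fun x => `|(v x ^+ 2)%:E|%E)) // => x _ /=.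
by rewrite ger0_norm // sqr_ge0.
Qed.

Lemma integrable_le (v w : E -> R) : measurable_fun D v ->
  leb.-integrable D (EFin \o w) -> (forall x, D x -> `|v x| <= w x) ->
  leb.-integrable D (EFin \o v).
Proof.
move=> mv iw vw; apply: (le_integrable mD _ _ iw).
  exact/measurable_EFinP.
by move=> x Dx /=; rewrite lee_fin (le_trans (vw x Dx)) // ler_norm.
Qed.

Lemma integrable_lincomb a b v w :
  leb.-integrable D (EFin \o v) -> leb.-integrable D (EFin \o w) ->
  leb.-integrable D (EFin \o (lincomb a v b w)).
Proof.
move=> iv iw; rewrite (_ : EFin \o _ =
  (fun x => a%:E * (v x)%:E) \+ (fun x => b%:E * (w x)%:E))%E //.
by apply: integrableD => //; exact: integrableZl.
Qed.

Lemma Rintegral_lincomb a b v w :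
  leb.-integrable D (EFin \o v) -> leb.-integrable D (EFin \o w) ->
  \int[leb]_(x in D) lincomb a v b w x
  = a * \int[leb]_(x in D) v x + b * \int[leb]_(x in D) w x.
Proof.
move=> iv iw; rewrite RintegralD ?RintegralZl //.
  by rewrite (_ : EFin \o _ = (fun x => a%:E * (v x)%:E))%E //; exact: integrableZl.
by rewrite (_ : EFin \o _ = (fun x => b%:E * (w x)%:E))%E //; exact: integrableZl.
Qed.

(** Dominated by $v^2+w^2$. *)
Lemma L2_integrable_mul v w : LL v -> LL w -> leb.-integrable D (EFin \o (fun x => v x * w x)).
Proof.
move=> lv lw; apply: (@integrable_le _ (lincomb 1 (fun x => v x ^+ 2) 1 (fun x => w x ^+ 2))).
- by apply: measurable_funM; [case: lv|case: lw].
- by apply: integrable_lincomb; exact: L2_integrable_sqr.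
- move=> x _; rewrite /lincomb ler_norml; apply/andP; split; have := sqr_ge0 (v x - w x);
    have := sqr_ge0 (v x + w x); have := sqr_ge0 (v x); have := sqr_ge0 (w x); nra.
Qed.

Lemma L2_lincomb a b v w : LL v -> LL w -> LL (lincomb a v b w).
Proof.
move=> lv lw; apply: integrable_sqr_L2.
  by apply: measurable_funD; apply: measurable_funM => //; [case: lv|case: lw].
have := integrable_lincomb (a ^+ 2) 1 (L2_integrable_sqr lv)
  (integrable_lincomb (2 * a * b) (b ^+ 2) (L2_integrable_mul lv lw) (L2_integrable_sqr lw)).
apply: eq_integrable => // x _ /=; congr (_%:E); rewrite /lincomb; ring.
Qed.

Lemma L2_integrable v : LL v -> leb.-integrable D (EFin \o v).
Proof.
move=> lv; have := L2_integrable_mul lv (L2_cst 1 mD Doo).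
by apply: eq_integrable => // x _ /=; rewrite mulr1.
Qed.

Lemma innerC v w : inner s v w = inner s w v.
Proof. by rewrite /inner; under eq_Rintegral do rewrite mulrC. Qed.

Lemma inner_lincombl a b v w u : LL v -> LL w -> LL u ->
  inner s (lincomb a v b w) u = a * inner s v u + b * inner s w u.
Proof.
move=> lv lw lu; rewrite /inner -Rintegral_lincomb; last 2 first.
- exact: L2_integrable_mul.
- exact: L2_integrable_mul.
by apply: eq_Rintegral => x _; rewrite /lincomb; ring.
Qed.

Lemma inner_lincombr a b v w u : LL v -> LL w -> LL u ->
  inner s u (lincomb a v b w) = a * inner s u v + b * inner s u w.
Proof. by move=> lv lw lu; rewrite innerC inner_lincombl // !(innerC u). Qed.

Lemma inner_ge0 v : 0 <= inner s v v.
Proof. by apply: Rintegral_ge0 => x _; rewrite -expr2 sqr_ge0. Qed.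

(** The expansion of $\|av+bw\|^2$; it is the source of Cauchy-Schwarz and of every use of Young's
    inequality below. *)
Lemma inner_quadratic_ge0 a b v w : LL v -> LL w ->
  0 <= a ^+ 2 * inner s v v + 2 * a * b * inner s v w + b ^+ 2 * inner s w w.
Proof.
move=> lv lw; have := inner_ge0 (lincomb a v b w).
rewrite inner_lincombl ?inner_lincombr //; try exact: L2_lincomb.
rewrite (innerC w v); lra.
Qed.

Lemma inner_CS v w : LL v -> LL w -> inner s v w ^+ 2 <= inner s v v * inner s w w.
Proof.
move=> lv lw; have H a b := inner_quadratic_ge0 a b lv lw.
have v0 := inner_ge0 v; have w0 := inner_ge0 w.
(* Functions are not identified modulo null sets, so [inner s v v] may vanish for nonzero [v]. The
   weights in this case leave $-(2+\|w\|^2)(v,w)^2\ge0$. *)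
have [vz|vn] := eqVneq (inner s v v) 0.
  have := H (- (1 + inner s w w)) (inner s v w); rewrite vz => h.
  have := mulr_ge0 (sqr_ge0 (inner s v w)) w0; lra.
have := H (inner s v w) (- inner s v v).
have : 0 < inner s v v by rewrite lt_def vn.
move: (inner s v v) (inner s v w) (inner s w w) => A B C A0 h.
rewrite -(@ler_pM2l _ A) //; lra.
Qed.

Lemma norm2_sqr v : norm2 s v ^+ 2 = inner s v v.
Proof. by rewrite /norm2 sqr_sqrtr // inner_ge0. Qed.

Lemma norm2_ge0 v : 0 <= norm2 s v.
Proof. exact: sqrtr_ge0. Qed.

Lemma inner_le_norm2 v w : LL v -> LL w -> `|inner s v w| <= norm2 s v * norm2 s w.
Proof.
move=> lv lw; rewrite -(@ler_pXn2r _ 2) ?nnegrE ?mulr_ge0 ?norm2_ge0 //.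
by rewrite exprMn !norm2_sqr real_normK ?num_real // inner_CS.
Qed.

Lemma norm2_triangle a b v w : LL v -> LL w ->
  norm2 s (lincomb a v b w) <= `|a| * norm2 s v + `|b| * norm2 s w.
Proof.
move=> lv lw.
have v0 := norm2_ge0 v; have w0 := norm2_ge0 w.
rewrite -(@ler_pXn2r _ 2) ?nnegrE ?addr_ge0 ?mulr_ge0 ?norm2_ge0 //.
rewrite norm2_sqr inner_lincombl ?inner_lincombr //; try exact: L2_lincomb.
rewrite (innerC w v) -!norm2_sqr sqrrD !exprMn !real_normK ?num_real //.
have : a * b * inner s v w <= `|a| * `|b| * (norm2 s v * norm2 s w).
  apply: le_trans (ler_norm _) _; rewrite !normrM ler_wpM2l ?mulr_ge0 //.
  exact: inner_le_norm2.
rewrite -mulr_natr; lra.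
Qed.

Lemma Rintegral_ae (v w : E -> R) : measurable_fun D v -> measurable_fun D w ->
  ae_equal s v w -> \int[leb]_(x in D) v x = \int[leb]_(x in D) w x.
Proof.
move=> mv mw vw; congr fine; apply: ae_eq_integral => //; try exact/measurable_EFinP.
by apply: filterS vw => x vw Dx /=; rewrite vw.
Qed.

Lemma L2_ae v w : measurable_fun D w -> ae_equal s v w -> LL v -> LL w.
Proof.
move=> mw vw lv; have [mv vfin] := lv; split => //; apply: le_lt_trans vfin.
rewrite (@ae_eq_integral _ _ _ leb D (fun x => (v x ^+ 2)%:E)) //.
- by apply/measurable_EFinP; exact: measurable_funX.
- by apply/measurable_EFinP; exact: measurable_funX.
- by apply: filterS vw => x vw Dx /=; rewrite vw.
Qed.

Lemma inner_ae v w u : LL v -> LL w -> LL u -> ae_equal s v w -> inner s v u = inner s w u.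
Proof.
move=> [mv _] [mw _] [mu _] vw; apply: Rintegral_ae; try exact: measurable_funM.
by apply: filterS vw => x vw Dx /=; rewrite vw.
Qed.

Lemma norm2_ae v w : LL v -> LL w -> ae_equal s v w -> norm2 s v = norm2 s w.
Proof.
by move=> lv lw vw; rewrite /norm2 (inner_ae lv lw lv vw) innerC (inner_ae lv lw lw vw).
Qed.

Lemma mean_inner v : mean s v = (vol s)^-1 * inner s v (cst 1).
Proof. by rewrite /mean /inner; under [in RHS]eq_Rintegral do rewrite mulr1. Qed.

End L2.

(** * Self-adjoint square roots *)

Section SquareRoot.
Context (R : realType) (d : nat) (s : setting R d) (hs : admissible s).
Local Notation E := 'rV[R]_d.
Local Notation LL := (L2 (dom s)).
Context (K : set (E -> R)) (T S : operator R d).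
Hypothesis KL : K `<=` LL.
Hypothesis Klin : forall a b v w, K v -> K w -> K (lincomb a v b w).
Hypothesis HS : is_sqrt_op s K T S.
Implicit Types u v w x y z : E -> R.

Lemma sqrt_op_in v w : S (v, w) -> K v /\ K w.
Proof. by case: HS => H _ _ _ _; exact: H. Qed.

Lemma sqrt_op_sym v w x y : S (v, w) -> S (x, y) -> inner s v y = inner s w x.
Proof.
case: HS => H _ sa _ _ vw xy; have [Kv Kw] := H _ _ vw.
exact: (sa v w Kv Kw).1 vw x y xy.
Qed.

(** Linearity comes from self-adjointness: a pair of elements of [K] is in the graph exactly when it
    satisfies the symmetry identity against the whole graph, a condition linear in the pair. *)
Lemma sqrt_op_lincomb a b v w x y : S (v, w) -> S (x, y) ->
  S (lincomb a v b x, lincomb a w b y).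
Proof.
move=> vw xy; have [Kv Kw] := sqrt_op_in vw; have [Kx Ky] := sqrt_op_in xy.
case: HS => H _ sa _ _; apply/sa; try exact: Klin.
move=> p q pq; have [Kp Kq] := H _ _ pq.
rewrite !(inner_lincombl hs) //; try exact: KL.
by rewrite (sqrt_op_sym vw pq) (sqrt_op_sym xy pq).
Qed.

(** Membership in the graph only depends on inner products with [K]; representatives can be
    exchanged once they agree when tested. *)
Lemma sqrt_op_eq v w v' w' : S (v, w) -> K v' -> K w' ->
  (forall x, K x -> inner s v x = inner s v' x) ->
  (forall x, K x -> inner s w x = inner s w' x) -> S (v', w').
Proof.
move=> vw Kv' Kw' vv' ww'; case: HS => H _ sa _ _; apply/sa => // p q pq.
have [Kp Kq] := H _ _ pq.
by rewrite -vv' // -ww' //; exact: sqrt_op_sym.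
Qed.

Lemma sqrt_op_sqr v z w : S (v, z) -> S (z, w) -> T (v, w).
Proof. by case: HS => _ _ _ _ TE vz zw; apply/TE; exists z. Qed.

Lemma sqrt_op_dense_eq0 u : K u -> (forall x y, S (x, y) -> inner s u x = 0) ->
  inner s u u = 0.
Proof.
case: HS => H dense _ _ _ Ku u0; apply/eqP; rewrite eq_le inner_ge0 andbT leNgt.
apply/negP => uu; have n0 : 0 < norm2 s u by rewrite sqrtr_gt0.
(* An element [x] of the domain with $\|u-x\|<\|u\|$ contradicts
   $\|u\|^2=(u,u-x)\le\|u\|\,\|u-x\|$. *)
have [x [y [xy]]] := dense u (norm2 s u) Ku n0.
have [Kx _] := H _ _ xy.
have -> : u \- x = lincomb 1 u (-1) x by apply/funext => p; rewrite /lincomb /=; ring.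
apply/negP; rewrite -leNgt -(@ler_pM2l _ (norm2 s u)) //.
apply: le_trans (inner_le_norm2 hs (KL Ku) (L2_lincomb hs 1 (-1) (KL Ku) (KL Kx))).
rewrite (inner_lincombr hs) ?(u0 _ _ xy) //; try exact: KL.
rewrite -expr2 norm2_sqr mul1r mulr0 addr0; exact: ler_norm.
Qed.

(** The difference of two values is orthogonal to the dense domain, hence has norm zero. *)
Lemma sqrt_op_uniq v w w' x : S (v, w) -> S (v, w') -> K x -> inner s w x = inner s w' x.
Proof.
move=> vw vw' Kx; have [Kv Kw] := sqrt_op_in vw; have [_ Kw'] := sqrt_op_in vw'.
pose u := lincomb 1 w (-1) w'.
have Ku : K u by exact: Klin.
have u0 : inner s u u = 0.
  apply: sqrt_op_dense_eq0 => // y z yz; have [Ky _] := sqrt_op_in yz.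
  rewrite (inner_lincombl hs) ?(sqrt_op_sym vw yz) //; try exact: KL.
  by rewrite -(sqrt_op_sym vw yz) -(sqrt_op_sym vw' yz); ring.
have := inner_CS hs (KL Ku) (KL Kx).
rewrite u0 mul0r => h; have : inner s u x ^+ 2 == 0 by rewrite eq_le h sqr_ge0.
rewrite sqrf_eq0 (inner_lincombl hs) //; try exact: KL.
by move/eqP; lra.
Qed.

Lemma sqrt_op_norm_inj v w w' : S (v, w) -> S (v, w') -> norm2 s w = norm2 s w'.
Proof.
move=> vw vw'; have [_ Kw] := sqrt_op_in vw; have [_ Kw'] := sqrt_op_in vw'.
by rewrite /norm2 (sqrt_op_uniq vw vw' Kw) innerC (sqrt_op_uniq vw vw' Kw').
Qed.

Lemma op_norm_sqrt_op v w : S (v, w) -> op_norm s S v = (norm2 s w)%:E.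
Proof.
move=> vw; rewrite /op_norm (_ : [set _ | _ in _] = [set (norm2 s w)%:E]) ?ereal_inf1 //.
apply/seteqP; split => [_ [w' /= vw' <-]|_ ->] /=; last by exists w.
by rewrite (sqrt_op_norm_inj vw vw').
Qed.

End SquareRoot.

Section SqrtOpGen.
Context (R : realType) (d : nat) (s : setting R d).
Local Notation E := 'rV[R]_d.

(* [xget] returns the empty graph when no square root exists, so a single element of
   the graph certifies that [sqrt_op] is one. *)
Lemma sqrt_opP (K : set (E -> R)) (T : operator R d) v w :
  sqrt_op s K T (v, w) -> is_sqrt_op s K T (sqrt_op s K T).
Proof.
rewrite /sqrt_op => vw; apply: (@xgetPex _ set0 [set S | is_sqrt_op s K T S]).
apply: contrapT => nex; move: vw; rewrite xgetPN // => S HS; apply: nex.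
by exists S.
Qed.

(** The infimum of the empty set is [+oo], so a finite bound certifies membership in the domain. *)
Lemma op_norm_lty (T : operator R d) v : (op_norm s T v < +oo)%E -> exists w, T (v, w).
Proof.
move=> vfin; apply: contrapT => nex; move: vfin.
rewrite /op_norm (_ : [set _ | _ in _] = set0) ?ereal_inf0 //.
by apply/seteqP; split => [_ [w /= vw _]|//]; apply: nex; exists w.
Qed.

End SqrtOpGen.

(** * Discrete differential inequalities *)

Section DiscreteInequalities.
Context (R : realType) (t : nat -> R).
Hypothesis ht : time_mesh t.
Local Notation k := (step t).

Lemma step_gt0 n : 0 < k n.
Proof. by case: ht => _ H _; rewrite subr_gt0. Qed.

Lemma mesh_addS n N : t (n + N.+1)%N = t (n + N)%N + k (n + N)%N.
Proof. by rewrite addnS /step addrC subrK. Qed.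

Lemma mesh_le m n : (m <= n)%N -> t m <= t n.
Proof.
move=> /subnKC <-; elim: (n - m)%N => [|N IH]; first by rewrite addn0.
by rewrite mesh_addS; have := step_gt0 (m + N); lra.
Qed.

Lemma mesh_unbounded (A : R) m : exists2 n, (m < n)%N & A <= t n.
Proof.
case: ht => _ _ /cvgryPge /(_ A)[N _ HN]; exists (maxn N m.+1).
  by rewrite (leq_trans _ (leq_maxr _ _)).
by apply: HN; rewrite /= leq_maxl.
Qed.

(** With $p=\varepsilon/g^2$ one step reads $(1+2kp)a'\le a+2kC_1$. The summand $8\varepsilon/c^2$
    of [T] is slack for the implicit step: it makes $e^{-t/T}$ decay slowly enough to be propagated
    by this recursion. *)
Lemma decay_bound (a b : nat -> R) (g eps c C1 rad : R) :
  0 < g -> 0 < eps -> 0 < c -> 0 <= C1 ->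
  (forall n, k n < 2 * eps / c ^+ 2) ->
  (forall n, a n.+1 - a n <= 2 * k n * (C1 - eps * b n.+1)) ->
  (forall n, a n.+1 <= g ^+ 2 * b n.+1) -> a 0%N <= rad ^+ 2 ->
  let T := g ^+ 2 / eps + 8 * eps / c ^+ 2 in
  forall n, a n <= expR (- (t n / T)) * rad ^+ 2 + C1 * T.
Proof.
move=> g0 e0 c0 C10 hk ha hab a0 T.
have c20 : 0 < c ^+ 2 by rewrite exprn_gt0.
have g20 : 0 < g ^+ 2 by rewrite exprn_gt0.
set q := eps / c ^+ 2; set p := eps / g ^+ 2.
have q0 : 0 < q by rewrite divr_gt0.
have p0 : 0 < p by rewrite divr_gt0.
have TE : T = p^-1 + 8 * q by rewrite /T /p /q; field; rewrite !gt_eqF.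
have pT : p * T = 1 + 8 * (p * q) by rewrite TE mulrDr mulfV ?gt_eqF //; ring.
have T0 : 0 < T by rewrite TE addr_gt0 // ?invr_gt0 // mulr_gt0.
elim=> [|n IH].
  by case: ht => -> _ _; rewrite mul0r oppr0 expR0 mul1r; have := mulr_ge0 C10 (ltW T0); lra.
have kn := step_gt0 n; have kq : k n < 2 * q by have := hk n; rewrite /q; lra.
have tS : t n.+1 = t n + k n by rewrite /step addrC subrK.
have step1 : (1 + 2 * k n * p) * a n.+1 <= a n + 2 * k n * C1.
  have h1 : p * a n.+1 <= eps * b n.+1.
    by rewrite /p mulrAC ler_pdivrMr // -mulrA ler_pM2l // mulrC.
  have := ler_wpM2l (ltW kn) h1; have := ha n; lra.
set X := expR (- (t n / T)) * rad ^+ 2 in IH.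
have X0 : 0 <= X by rewrite mulr_ge0 ?expR_ge0 ?sqr_ge0.
(* Uses $e^{-x}\ge1-x$ with $x=k/T$. *)
have XS : X * (1 - k n / T) <= expR (- (t n.+1 / T)) * rad ^+ 2.
  have -> : - (t n.+1 / T) = - (t n / T) + - (k n / T) by rewrite tS; ring.
  rewrite expRD [leRHS]mulrAC -/X ler_wpM2l //.
  by have := expR_ge1Dx (- (k n / T)).
have kp0 : 0 < 1 + 2 * k n * p by have := mulr_gt0 kn p0; lra.
rewrite -(@ler_pM2l _ (1 + 2 * k n * p)) //.
apply: (le_trans step1).
(* After multiplication by $T$ the excess is $k(2pT-1-2kp)$, where $pT=1+8pq$ and $k<2q$ make the
   bracket positive. *)
have Y : 1 <= (1 + 2 * k n * p) * (1 - k n / T).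
  have kT : k n / T * T = k n by rewrite divfK ?gt_eqF.
  rewrite -(@ler_pM2r _ T) //.
  have -> : (1 + 2 * k n * p) * (1 - k n / T) * T = (1 + 2 * k n * p) * (T - k n / T * T) by ring.
  rewrite kT.
  have -> : (1 + 2 * k n * p) * (T - k n) = T + k n * (2 * (p * T) - 1 - 2 * k n * p) by ring.
  rewrite pT.
  have := ler_wpM2r (ltW p0) (ltW kq); have := mulr_gt0 p0 q0 => pq0 h.
  have : 0 <= k n * (2 * (1 + 8 * (p * q)) - 1 - 2 * k n * p).
    by rewrite mulr_ge0 ?(ltW kn) //; lra.
  lra.
have Z := ler_wpM2l X0 Y.
have W := ler_wpM2l (ltW kp0) XS.
have V : (1 + 2 * k n * p) * (C1 * T) = C1 * T + 2 * k n * C1 * (p * T) by ring.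
rewrite [leRHS]mulrDr V pT.
have := mulr_ge0 (mulr_ge0 (ltW kn) C10) (ltW (mulr_gt0 p0 q0)).
lra.
Qed.

(** Summing the first inequality averages the energy over the elapsed time. As
    $J=\frac\varepsilon2b+\Phi$ is nonincreasing and at most $\varepsilon b+\Phi$, its last value
    stands in for the average. *)
Lemma energy_average (a b Phi : nat -> R) (eps C0 : R) (n0 N : nat) :
  0 < eps -> (0 < n0)%N -> (forall n, 0 <= b n) ->
  (forall n, a n.+1 - a n <= 2 * k n * (C0 - (eps * b n.+1 + Phi n.+1))) ->
  (forall n, (0 < n)%N -> eps / 2 * b n.+1 + Phi n.+1 <= eps / 2 * b n + Phi n) ->
  a (n0 + N)%N + 2 * (t (n0 + N)%N - t n0)
    * (eps / 2 * b (n0 + N)%N + Phi (n0 + N)%N - C0) <= a n0.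
Proof.
move=> e0 n00 b0 ha hJ; elim: N => [|N IH]; first by rewrite addn0 subrr; lra.
rewrite mesh_addS !addnS; set n := (n0 + N)%N in IH *.
have kn := step_gt0 n; have D0 : 0 <= t n - t n0 by rewrite subr_ge0 mesh_le // leq_addr.
have Jn := hJ n (ltn_addr _ n00).
have h1 : eps / 2 * b n.+1 + Phi n.+1 - C0 <= eps * b n.+1 + Phi n.+1 - C0.
  by have := mulr_ge0 (ltW e0) (b0 n.+1); lra.
have := ler_wpM2l (ltW kn) h1.
have := ler_wpM2l D0 Jn.
have := ha n.
lra.
Qed.

(** Once [J] is near its infimum, little energy is left to feed [w]; and [w] must be small at some
    later index, or the dissipation would be infinite. *)
Lemma dissipation_small (w J : nat -> R) (D m tau : R) (n1 : nat) :
  0 < D -> 0 < tau -> (forall n, 0 <= w n) -> (forall n, (0 < n)%N -> m <= J n) ->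
  (forall n, (0 < n)%N -> w n.+1 - w n <= D * (k n * w n.+1)) ->
  (forall n, (0 < n)%N -> J n.+1 + 3 / 4 * (k n * w n.+1) <= J n) ->
  exists2 n2, (n1 < n2)%N & forall n, (n2 <= n)%N -> w n <= tau.
Proof.
move=> D0 tau0 w0 Jm hw hJ.
have Jdec p N : (0 < p)%N -> J (p + N)%N <= J p.
  move=> p0; elim: N => [|N]; first by rewrite addn0.
  rewrite addnS => IH; have := hJ (p + N)%N (ltn_addr _ p0).
  by have := mulr_ge0 (ltW (step_gt0 (p + N))) (w0 (p + N).+1); lra.
pose A := [set J n | n in [set n | (0 < n)%N]].
have infA : has_inf A.
  split; first by exists (J 1%N), 1%N.
  by exists m => _ [n /= n0 <-]; exact: Jm.
(* Chosen so that $\frac43D\cdot$[del]$=\tau/2$, the growth still allowed after [w] has reached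
   $\tau/2$. *)
pose del := 3 / 8 * tau / D.
have del0 : 0 < del by rewrite !divr_gt0 // mulr_gt0 // divr_gt0.
have [_ [p /= p0 <-] pJ] := inf_adherent del0 infA.
have Jp n : (0 < n)%N -> J p - J n <= del.
  move=> n0; have : inf A <= J n by apply: ge_inf; [case: infA|exists n].
  by lra.
pose q := maxn p n1.
have q0 : (0 < q)%N by rewrite (leq_trans p0) // leq_maxl.
(* Otherwise [J] loses at least $\frac38\tau$ per unit of time from [q] on and falls below [m],
   since the mesh is unbounded. *)
have [N wN] : exists N, w (q + N).+1 <= tau / 2.
  apply: contrapT => nex.
  have big N : tau / 2 <= w (q + N).+1.
    by rewrite leNgt; apply/negP => h; apply: nex; exists N; exact: ltW.
  have JN N : J (q + N)%N <= J q - 3 / 8 * tau * (t (q + N)%N - t q).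
    elim: N => [|N IH]; first by rewrite addn0 subrr; lra.
    rewrite mesh_addS addnS; have := hJ (q + N)%N (ltn_addr _ q0).
    have := ler_wpM2l (ltW (step_gt0 (q + N))) (big N); lra.
  have [n qn nt] := mesh_unbounded (t q + (J q - m + 1) / (3 / 8 * tau)) q.
  have := JN (n - q)%N; rewrite subnKC; last exact: ltnW.
  have := Jm n (ltn_trans q0 qn).
  have t30 : 0 < 3 / 8 * tau by rewrite mulr_gt0 // divr_gt0.
  have h : (J q - m + 1) / (3 / 8 * tau) <= t n - t q by lra.
  by rewrite ler_pdivrMr // in h; lra.
exists (q + N).+1; first by rewrite ltnS (leq_trans (leq_maxr p n1)) // leq_addr.
move=> n nN.
(* $w+\frac43DJ$ is nonincreasing: growth of [w] is paid for by loss of [J]. *)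
have step_w i : w ((q + N).+1 + i)%N <=
    w (q + N).+1 + 4 / 3 * D * (J (q + N).+1 - J ((q + N).+1 + i)%N).
  elim: i => [|i IH]; first by rewrite addn0 subrr; lra.
  rewrite addnS; set r := ((q + N).+1 + i)%N in IH *.
  have r0 : (0 < r)%N by rewrite /r addSn.
  have := hw r r0; have := ler_wpM2l (ltW D0) (hJ r r0); lra.
have := step_w (n - (q + N).+1)%N; rewrite subnKC // => h.
have h1 : J (q + N).+1 <= J p.
  have -> : (q + N).+1 = (p + ((q - p) + N).+1)%N by rewrite addnS addnA subnKC // leq_maxl.
  exact: Jdec.
have n0 : (0 < n)%N by exact: leq_trans nN.
have h2 : J (q + N).+1 - J n <= del by have := Jp n n0; lra.
have := ler_wpM2l (ltW D0) h2.
have -> : D * del = 3 / 8 * tau by rewrite /del mulrC divfK ?gt_eqF.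
lra.
Qed.

End DiscreteInequalities.

(** * The nonlinearity *)

Lemma MVT_two_sided (R : realType) (g : R -> R) (x y : R) :
  (forall z, derivable g z 1) ->
  exists2 z, (x <= z <= y) || (y <= z <= x) & g y - g x = derive1 g z * (y - x).
Proof.
move=> dg.
have main a b : a <= b -> exists2 z, a <= z <= b & g b - g a = derive1 g z * (b - a).
  move=> ab.
  have gc : {within `[a, b], continuous g} by apply: derivable_within_continuous => z _.
  have isd (z : R) : z \in `]a, b[ -> is_derive z 1 g (derive1 g z).
    by move=> _; rewrite derive1E; exact: derivableP.
  by have [z] := MVT_segment ab isd gc; rewrite in_itv /=; exists z.
have [xy|/ltW yx] := leP x y.
  by have [z zxy e] := main x y xy; exists z => //; rewrite zxy.
by have [z zxy e] := main y x yx; exists z; [rewrite zxy orbT|lra].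
Qed.

Section Semiconvex.
Context (R : realType) (F : R -> R) (c : R).
Hypothesis hF1 : forall x : R, derivable F x 1.
Hypothesis hF2 : forall x : R, derivable (derive1 F) x 1.
Hypothesis hd2 : forall v, - c <= derive1n 2 F v.
Local Notation f := (derive1 F).

(** The mean value theorem for [f], whose derivative is at least $-c$. *)
Lemma derive1_semimonotone x y : - c * (y - x) ^+ 2 <= (f y - f x) * (y - x).
Proof.
have [z _ ->] := MVT_two_sided x y hF2.
rewrite -mulrA -expr2 ler_wpM2r ?sqr_ge0 //.
exact: hd2.
Qed.

(** $F+\frac c2z^2$ is convex, hence above its tangent at [y]. The slope is taken at [y] because the
    scheme evaluates [f] at the new time level. *)
Lemma semiconvex_le x y : F y - F x <= f y * (y - x) + c / 2 * (y - x) ^+ 2.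
Proof.
pose g (z : R) := F z + (c / 2) * z ^+ 2.
have dg (z : R) : is_derive z 1 g (f z + c * z).
  have dF : is_derive z 1 F (f z) by rewrite derive1E; exact: derivableP.
  apply: is_derive_eq; rewrite /GRing.scale /=; lra.
have dg1 (z : R) : derivable g z 1 by exact: (@ex_derive _ _ _ _ _ _ _ (dg z)).
have [z zxy] := MVT_two_sided x y dg1.
have -> : derive1 g z = f z + c * z by rewrite derive1E; exact: (@derive_val _ _ _ _ _ _ _ (dg z)).
rewrite /g.
(* $f+cz$ is nondecreasing, and [z] lies between [x] and [y] in either order. *)
have zy : (f z + c * z) * (y - x) <= (f y + c * y) * (y - x).
  have H := derive1_semimonotone z y.
  case/orP: zxy => /andP[h1 h2].
    have [->//|zny] := eqVneq z y.
    have yz : 0 < y - z by rewrite subr_gt0 lt_def eq_sym zny.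
    have h3 : 0 <= f y + c * y - (f z + c * z).
      rewrite -(@ler_pM2r _ (y - z)) // mul0r; lra.
    have xy : 0 <= y - x by lra.
    have := mulr_ge0 h3 xy; lra.
  have [->//|zny] := eqVneq z y.
  have yz : 0 < z - y by rewrite subr_gt0 lt_def zny.
  have h3 : 0 <= f z + c * z - (f y + c * y).
    rewrite -(@ler_pM2r _ (z - y)) // mul0r; lra.
  have xy : 0 <= x - y by lra.
  have := mulr_ge0 h3 xy; lra.
move=> h; lra.
Qed.

Lemma derive1_continuous_of_derivable2 : continuous f.
Proof. by move=> x; apply: differentiable_continuous; apply/derivable1_diffP. Qed.

Lemma continuous_of_derivable1 : continuous F.
Proof. by move=> x; apply: differentiable_continuous; apply/derivable1_diffP. Qed.

End Semiconvex.

(* If the constant vanished then [c1 = c2a = 0], and at [v = p / (2 eta)] the two growth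
   conditions would give [p <= eta v = p / 2]. *)
Lemma growth_constant_gt0 (R : realType) (f : R -> R) (F : R -> R) (p : nat)
    (c0 c1 c2a c3 alpha : R) :
  (2 <= p)%N -> 0 < c0 -> 0 < alpha ->
  (forall v, p%:R * c0 * v ^+ (2 * p) - c1 <= f v * v) ->
  (forall v, `|f v| <= 1 / alpha * (p%:R - 3 / 2) * c0 * v ^+ (2 * p) + c2a) ->
  (forall v, 1 / 2 * c0 * v ^+ (2 * p) - c3 <= F v
          /\ F v <= 3 / 2 * c0 * v ^+ (2 * p) + c3) ->
  [/\ 0 <= c1, 0 <= c2a, 0 <= c3 & 0 < c1 + c2a * alpha + 2 * c3].
Proof.
move=> p2 c00 al0 ha hb hcF.
have p2R : (2 : R) <= p%:R by rewrite ler_nat.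
have z0 : (0 : R) ^+ (2 * p) = 0 by rewrite expr0n muln_eq0 /=; case: p p2 {ha hb hcF p2R}.
have c10 : 0 <= c1 by have := ha 0; rewrite z0 !mulr0; lra.
have c20 : 0 <= c2a by have := hb 0; rewrite z0 !mulr0 add0r; apply: le_trans.
have c30 : 0 <= c3 by have [] := hcF 0; rewrite z0 !mulr0; lra.
split => //; rewrite lt_def; apply/andP; split; last first.
  by rewrite !addr_ge0 // mulr_ge0 // ltW.
apply/eqP => e.
have c2al : 0 <= c2a * alpha by rewrite mulr_ge0 // ltW.
have c1E : c1 = 0 by lra.
have : c2a * alpha == 0 by apply/eqP; lra.
rewrite mulf_eq0 (gt_eqF al0) orbF => /eqP c2E.
set eta := 1 / alpha * (p%:R - 3 / 2) in hb.
have eta0 : 0 < eta by rewrite mulr_gt0 ?divr_gt0 //; lra.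
pose v := p%:R / (2 * eta).
have v0 : 0 < v by apply: divr_gt0; [lra|exact: mulr_gt0].
have := ha v; have := hb v; rewrite c1E c2E subr0 addr0 => h1 h2.
have V : 0 < c0 * v ^+ (2 * p) by rewrite mulr_gt0 // exprn_gt0.
have h3 : f v * v <= eta * c0 * v ^+ (2 * p) * v.
  by rewrite ler_pM2r //; apply: le_trans h1; exact: ler_norm.
have ev : eta * v = p%:R / 2 by rewrite /v; field; rewrite gt_eqF.
have := le_trans h2 h3.
have -> : eta * c0 * v ^+ (2 * p) * v = (eta * v) * (c0 * v ^+ (2 * p)) by ring.
rewrite ev -mulrA ler_pM2r //; lra.
Qed.

(** * Integrals of the nonlinearity over the domain *)

Section Nonlinearity.
Context (R : realType) (d : nat) (s : setting R d) (hs : admissible s).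
Local Notation E := 'rV[R]_d.
Local Notation leb := (@lebesgue_rV R d).
Local Notation LL := (L2 (dom s)).
Context (F : R -> R) (p : nat) (c0 c1 c2a c3 alpha c : R).
Local Notation f := (derive1 F).
Hypothesis hF1 : forall x : R, derivable F x 1.
Hypothesis hF2 : forall x : R, derivable (derive1 F) x 1.
Hypothesis hd2 : forall r : R, - c <= derive1n 2 F r.
Hypothesis hp : (2 <= p)%N.
Hypothesis hc0 : 0 < c0.
Hypothesis halpha : 0 < alpha.
Hypothesis ha : forall r : R, p%:R * c0 * r ^+ (2 * p) - c1 <= f r * r.
Hypothesis hb : forall r : R, `|f r| <= 1 / alpha * (p%:R - 3 / 2) * c0 * r ^+ (2 * p) + c2a.
Hypothesis hcF : forall r : R, 1 / 2 * c0 * r ^+ (2 * p) - c3 <= F r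
                  /\ F r <= 3 / 2 * c0 * r ^+ (2 * p) + c3.
Implicit Types u v w : E -> R.

Let mD : measurable (dom s) := measurable_dom hs.

Definition potential v : R := \int[leb]_(x in dom s) F (v x).

Lemma even_power_ge0 (r : R) : 0 <= r ^+ (2 * p).
Proof. by rewrite exprM exprn_ge0 ?sqr_ge0. Qed.

Lemma integrable_cst_dom (r : R) : leb.-integrable (dom s) (EFin \o (cst r : E -> R)).
Proof. by apply: (L2_integrable hs); apply: L2_cst => //; exact: lebesgue_rV_dom_lty. Qed.

Lemma Rintegral_cst_dom (r : R) : \int[leb]_(x in dom s) (cst r x) = r * vol s.
Proof. exact: Rintegral_cst. Qed.

Lemma measurable_comp_continuous (g : R -> R) v : continuous g -> LL v ->
  measurable_fun (dom s) (g \o v).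
Proof. by move=> cg [mv _]; apply: measurableT_comp => //; exact: continuous_measurable_fun. Qed.

(** The growth conditions give $c_0v^{2p}\le f(v)v+c_1$, so $|F(v)|\le\frac32(f(v)v+c_1)+c_3$, and
    $f(v)v$ is a product of two $L^2$ functions. *)
Lemma integrable_potential v : LL v -> LL (f \o v) -> leb.-integrable (dom s) (EFin \o (F \o v)).
Proof.
move=> lv lf; have p2R : (2 : R) <= p%:R by rewrite ler_nat.
have ifv := L2_integrable_mul hs lf lv.
have i1 := integrable_lincomb hs 1 1 ifv (integrable_cst_dom c1).
have i2 := integrable_lincomb hs (3 / 2) 1 i1 (integrable_cst_dom c3).
have [c10 _ c30 _] := growth_constant_gt0 hp hc0 halpha ha hb hcF.
apply: (integrable_le hs _ i2).
  by apply: measurable_comp_continuous => //; exact: continuous_of_derivable1.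
move=> x _; rewrite /lincomb /= !mul1r.
have [h1 h2] := hcF (v x); have h3 := ha (v x).
have V := mulr_ge0 (ltW hc0) (even_power_ge0 (v x)).
have h4 : c0 * v x ^+ (2 * p) <= p%:R * c0 * v x ^+ (2 * p).
  by rewrite -mulrA -[leLHS]mul1r ler_wpM2r //; lra.
rewrite ler_norml; apply/andP; split; lra.
Qed.

Lemma potential_ge v : LL v -> LL (f \o v) -> - (c3 * vol s) <= potential v.
Proof.
move=> lv lf; rewrite -mulNr -Rintegral_cst_dom.
apply: le_Rintegral => //; first exact: integrable_cst_dom.
  exact: integrable_potential.
move=> x _ /=; have [h1 _] := hcF (v x).
by have := mulr_ge0 (ltW hc0) (even_power_ge0 (v x)); lra.
Qed.

(** Pointwise, $f(v)(v-m)\ge pc_0v^{2p}-c_1-\alpha|f(v)|$. The choice $\eta=\frac1\alpha(p-\frac32)$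
    leaves exactly $\frac32c_0v^{2p}$, which dominates $F(v)-c_3$. *)
Lemma inner_nonlinearity_centered v : LL v -> LL (f \o v) -> `|mean s v| <= alpha ->
  potential v - (c1 + c2a * alpha + c3) * vol s <= inner s (f \o v) (centered s v).
Proof.
move=> lv lf mv; have p2R : (2 : R) <= p%:R by rewrite ler_nat.
have lc : LL (centered s v).
  have -> : centered s v = lincomb 1 v (- mean s v) (cst 1).
    by apply/funext => x; rewrite /lincomb /centered /=; ring.
  by apply: L2_lincomb => //; apply: L2_cst => //; exact: lebesgue_rV_dom_lty.
have iF := integrable_potential lv lf.
have iC := integrable_cst_dom (c1 + c2a * alpha + c3).
have -> : potential v - (c1 + c2a * alpha + c3) * vol s =
    \int[leb]_(x in dom s) lincomb 1 (F \o v) (-1) (cst (c1 + c2a * alpha + c3)) x.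
  by rewrite (Rintegral_lincomb hs) // Rintegral_cst_dom mul1r mulN1r.
apply: le_Rintegral => //.
- exact: integrable_lincomb.
- exact: L2_integrable_mul.
move=> x _; rewrite /lincomb /centered /= mul1r mulN1r.
have [_ h2] := hcF (v x); have h3 := ha (v x); have h4 := hb (v x).
set m := mean s v in mv *.
have h5 : f (v x) * m <= alpha * `|f (v x)|.
  by apply: le_trans (ler_norm _) _; rewrite normrM mulrC ler_wpM2r.
have h6 := ler_wpM2l (ltW halpha) h4.
have e : alpha * (1 / alpha * (p%:R - 3 / 2) * c0 * v x ^+ (2 * p) + c2a)
  = (p%:R - 3 / 2) * c0 * v x ^+ (2 * p) + c2a * alpha by field; rewrite gt_eqF.
rewrite e in h6; lra.
Qed.

Lemma potential_semiconvex v w : LL v -> LL (f \o v) -> LL w -> LL (f \o w) ->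
  potential w - potential v <=
  inner s (f \o w) (lincomb 1 w (-1) v)
  + c / 2 * inner s (lincomb 1 w (-1) v) (lincomb 1 w (-1) v).
Proof.
move=> lv lfv lw lfw; have ld := L2_lincomb hs 1 (-1) lw lv.
have iv := integrable_potential lv lfv; have iw := integrable_potential lw lfw.
have i1 := L2_integrable_mul hs lfw ld; have i2 := L2_integrable_mul hs ld ld.
have -> : potential w - potential v = \int[leb]_(x in dom s) lincomb 1 (F \o w) (-1) (F \o v) x.
  by rewrite (Rintegral_lincomb hs) // mul1r mulN1r.
rewrite /inner -[X in _ <= X + _]mul1r -(Rintegral_lincomb hs) //.
apply: le_Rintegral => //; try exact: integrable_lincomb.
move=> x _; have := semiconvex_le hF1 hF2 hd2 (v x) (w x).
rewrite /lincomb /= -expr2; lra.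
Qed.

Lemma nonlinearity_semimonotone v w : LL v -> LL (f \o v) -> LL w -> LL (f \o w) ->
  - c * inner s (lincomb 1 w (-1) v) (lincomb 1 w (-1) v) <=
  inner s (lincomb 1 (f \o w) (-1) (f \o v)) (lincomb 1 w (-1) v).
Proof.
move=> lv lfv lw lfw; have ld := L2_lincomb hs 1 (-1) lw lv.
have lfd := L2_lincomb hs 1 (-1) lfw lfv.
have i1 := L2_integrable_mul hs ld ld; have i2 := L2_integrable_mul hs lfd ld.
rewrite /inner -RintegralZl //; apply: le_Rintegral => //.
  have := integrable_lincomb hs (- c) 0 i1 i1; apply: eq_integrable => // x _ /=.
  by congr (_%:E); rewrite [LHS]/lincomb mul0r addr0.
move=> x _; have := derive1_semimonotone hF2 hd2 (v x) (w x).
rewrite /lincomb /= -expr2 => h.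
have -> : 1 * w x + -1 * v x = w x - v x by ring.
by have -> : 1 * f (w x) + -1 * f (v x) = f (w x) - f (v x) by ring.
Qed.

End Nonlinearity.

(** * One step of the implicit Euler scheme *)

Section Operators.
Context (R : realType) (d : nat) (s : setting R d) (hs : admissible s).
Local Notation E := 'rV[R]_d.
Local Notation leb := (@lebesgue_rV R d).
Local Notation LL := (L2 (dom s)).
Local Notation B := (sqrt_op s LL (opA s)).
Hypothesis HB : is_sqrt_op s LL (opA s) B.
Implicit Types u v w x y z : E -> R.
Local Notation "'one'" := (cst 1 : E -> R).

Let LLsub : LL `<=` LL. Proof. by []. Qed.
Let LLlin a b v w : LL v -> LL w -> LL (lincomb a v b w).
Proof. exact: L2_lincomb. Qed.

Lemma L2_one : LL one.
Proof. by apply: L2_cst; [exact: measurable_dom|exact: lebesgue_rV_dom_lty]. Qed.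

Lemma inner_null x y : LL x -> LL y -> inner s x x = 0 -> inner s x y = 0.
Proof.
move=> lx ly x0; have := inner_CS hs lx ly; rewrite x0 mul0r => h.
by apply/eqP; rewrite -sqrf_eq0 eq_le h sqr_ge0.
Qed.

(** Writing $z=A^{1/2}1$, symmetry gives $\|z\|^2=(1,A^{1/2}z)=(1,A1)=0$. *)
Lemma sqrt_opA_one : B (one, cst 0).
Proof.
case: (HB) => _ _ _ _ TE; have /TE[z [oz zz]] := opA_cst1 hs.
have [_ Lz] := sqrt_op_in HB oz; have [_ L0] := sqrt_op_in HB zz.
have H0 x : inner s x (cst 0) = 0.
  rewrite /inner (@eq_Rintegral _ _ _ leb (dom s) (cst 0)) ?Rintegral_cst ?mul0r //.
    exact: measurable_dom.
  by move=> y _ /=; rewrite mulr0.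
have z0 : inner s z z = 0 by rewrite -(sqrt_op_sym HB oz zz) H0.
apply: (sqrt_op_eq HB oz) => // [|x Lx]; first exact: L2_one.
by rewrite inner_null // innerC H0.
Qed.

Lemma sqrt_opA_lincomb_one a v q b : B (v, q) -> B (lincomb a v b one, lincomb a q 0 q).
Proof.
move=> vq; have H := sqrt_op_lincomb hs LLsub LLlin HB a b vq sqrt_opA_one.
have -> // : lincomb a q 0 q = lincomb a q b (cst 0).
by apply/funext => x; rewrite /lincomb /=; ring.
Qed.

Lemma inner_opA_one q w : B (q, w) -> inner s w one = 0.
Proof.
move=> qw; rewrite innerC (sqrt_op_sym HB sqrt_opA_one qw).
rewrite /inner (@eq_Rintegral _ _ _ leb (dom s) (cst 0)) ?Rintegral_cst ?mul0r //.
  exact: measurable_dom.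
by move=> y _ /=; rewrite mul0r.
Qed.

Lemma centeredE v : centered s v = lincomb 1 v (- mean s v) one.
Proof. by apply/funext => x; rewrite /lincomb /centered /=; ring. Qed.

Lemma L2_centered v : LL v -> LL (centered s v).
Proof. by move=> lv; rewrite centeredE; apply: LLlin => //; exact: L2_one. Qed.

Lemma mean_lincomb a v b w : LL v -> LL w ->
  mean s (lincomb a v b w) = a * mean s v + b * mean s w.
Proof.
move=> lv lw; rewrite !mean_inner (inner_lincombl hs) //; last exact: L2_one.
by ring.
Qed.

Lemma mean_one : mean s one = 1.
Proof.
rewrite mean_inner /inner (@eq_Rintegral _ _ _ leb (dom s) (cst 1)).
  rewrite Rintegral_cst; last exact: measurable_dom.
  by rewrite mul1r mulVf // gt_eqF // (vol_gt0 hs).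
by move=> x _ /=; rewrite mulr1.
Qed.

Lemma mean_centered v : LL v -> mean s (centered s v) = 0.
Proof.
move=> lv; rewrite centeredE mean_lincomb ?mean_one //; last exact: L2_one.
by ring.
Qed.

Lemma inner_one_mean v : LL v -> inner s v one = vol s * mean s v.
Proof. by move=> lv; rewrite mean_inner mulrA mulfV ?mul1r // gt_eqF // (vol_gt0 hs). Qed.

(** [powA s 1] differs from the square root only by a final almost everywhere equality, which leaves
    the norms unchanged. *)
Lemma Hnorm1E v q : B (v, q) -> Hnorm s 1 v = (norm2 s q)%:E.
Proof.
move=> vq; have [_ Lq] := sqrt_op_in HB vq.
rewrite -(op_norm_sqrt_op hs LLsub LLlin HB vq) /Hnorm /op_norm; congr (ereal_inf _).
apply/seteqP; split => [_ [w /= [z [vz [/= Lz Lw zw]]] <-]|_ [w /= vw <-]].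
  by exists z => //; rewrite (norm2_ae hs Lz Lw zw).
have [_ Lw] := sqrt_op_in HB vw.
by exists w => //=; exists w; split => //; split => //=; apply: aeW => x _.
Qed.

(** * Energy, flux and dual estimates over one time step *)

Section Step.
Context (F : R -> R) (p : nat) (c0 c1 c2a c3 alpha c eps : R).
Local Notation f := (derive1 F).
Hypothesis hF1 : forall x : R, derivable F x 1.
Hypothesis hF2 : forall x : R, derivable (derive1 F) x 1.
Hypothesis hd2 : forall r : R, - c <= derive1n 2 F r.
Hypothesis hp : (2 <= p)%N.
Hypothesis hc0 : 0 < c0.
Hypothesis hc : 0 < c.
Hypothesis halpha : 0 < alpha.
Hypothesis heps : 0 < eps.
Hypothesis ha : forall r : R, p%:R * c0 * r ^+ (2 * p) - c1 <= f r * r.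
Hypothesis hb : forall r : R, `|f r| <= 1 / alpha * (p%:R - 3 / 2) * c0 * r ^+ (2 * p) + c2a.
Hypothesis hcF : forall r : R, 1 / 2 * c0 * r ^+ (2 * p) - c3 <= F r
                  /\ F r <= 3 / 2 * c0 * r ^+ (2 * p) + c3.

(* [om = eps A v + f v] is an identity of classes modulo null sets, so it is tested
   against L^2; the same holds for [euler_relation]. *)
Definition chemical_potential v Bv Av om Bom Aom : Prop :=
  [/\ B (v, Bv), B (Bv, Av), B (om, Bom), B (Bom, Aom)
    & LL (f \o v) /\
      forall x, LL x -> inner s om x = eps * inner s Av x + inner s (f \o v) x].

Definition euler_relation (k : R) v v' Aom : Prop :=
  forall x, LL x -> inner s (lincomb 1 v' (-1) v) x = - k * inner s Aom x.

(** Tests the evolution equation with the constant 1. *)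
Lemma euler_mean k v v' Bom Aom : LL v -> LL v' -> B (Bom, Aom) ->
  euler_relation k v v' Aom -> mean s v' = mean s v.
Proof.
move=> lv lv' bA /(_ _ L2_one); rewrite (inner_opA_one bA) mulr0 => h.
have := mean_lincomb 1 (-1) lv' lv; rewrite [LHS]mean_inner h mulr0.
lra.
Qed.

Section TwoLevels.
Context (k : R) (v v' Bv Bv' Av' om' Bom' Aom' : E -> R).
Hypothesis k0 : 0 < k.
Hypothesis vB : B (v, Bv).
Hypothesis lf : LL (f \o v).
Hypothesis level' : chemical_potential v' Bv' Av' om' Bom' Aom'.
Hypothesis evol : euler_relation k v v' Aom'.

Let dv := lincomb 1 v' (-1) v.
Let dBv := lincomb 1 Bv' (-1) Bv.

Let lv : LL v. Proof. by case: (sqrt_op_in HB vB). Qed.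
Let lBv : LL Bv. Proof. by case: (sqrt_op_in HB vB). Qed.
Let lv' : LL v'. Proof. by case: level' => /(sqrt_op_in HB)[]. Qed.
Let lBv' : LL Bv'. Proof. by case: level' => /(sqrt_op_in HB)[]. Qed.
Let lAv' : LL Av'. Proof. by case: level' => _ /(sqrt_op_in HB)[]. Qed.
Let lom' : LL om'. Proof. by case: level' => _ _ /(sqrt_op_in HB)[]. Qed.
Let lBom' : LL Bom'. Proof. by case: level' => _ _ /(sqrt_op_in HB)[]. Qed.
Let lf' : LL (f \o v'). Proof. by case: level' => _ _ _ _ []. Qed.
Let ldv : LL dv. Proof. exact: LLlin. Qed.
Let ldBv : LL dBv. Proof. exact: LLlin. Qed.

Let dvB : B (dv, dBv).
Proof. by case: level' => h _ _ _ _; exact: (sqrt_op_lincomb hs LLsub LLlin HB 1 (-1) h vB). Qed.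

(** Tests the evolution equation with the increment itself. *)
Let dv_sqr : inner s dv dv = - k * inner s dBv Bom'.
Proof.
case: level' => _ _ _ bA _.
by rewrite (evol ldv) innerC (sqrt_op_sym HB dvB bA).
Qed.

(** The weights match [dv_sqr]: the cross term is $-4\varepsilon c\|v'-v\|^2$, the error due to the
    nonconvexity of [F]. *)
Let young : 0 <= 4 * eps ^+ 2 * inner s dBv dBv + 4 * eps * c * k * inner s dBv Bom'
  + c ^+ 2 * k ^+ 2 * inner s Bom' Bom'.
Proof.
have := inner_quadratic_ge0 hs (2 * eps) (c * k) ldBv lBom'; lra.
Qed.

(** Tests the evolution with $\omega'$ and the potential with the increment. The error $\frac
    c2\|v'-v\|^2$ is at most $\frac\varepsilon2|v'-v|_1^2$, which the implicit step provides, plus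
    $\frac{c^2k^2}{8\varepsilon}|\omega'|_1^2\le\frac k4|\omega'|_1^2$; this leaves the factor
    $\frac34$. *)
Lemma energy_step : k < 2 * eps / c ^+ 2 ->
  (eps / 2 * inner s Bv' Bv' + potential s F v') + 3 / 4 * (k * inner s Bom' Bom')
  <= eps / 2 * inner s Bv Bv + potential s F v.
Proof.
move=> kc; case: level' => vB' BA' omB' BomA' [_ omE].
have e1 : inner s dv om' = - k * inner s Bom' Bom'.
  by rewrite (evol lom') innerC (sqrt_op_sym HB omB' BomA').
have e2 : inner s om' dv = eps * inner s dBv Bv' + inner s (f \o v') dv.
  by rewrite (omE _ ldv) (innerC s Av') (sqrt_op_sym HB dvB BA').
have e3 : inner s dBv Bv' = inner s Bv' Bv' - inner s Bv Bv'.
  by rewrite (inner_lincombl hs) //; ring.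
have e4 : inner s dBv dBv = inner s Bv' Bv' - 2 * inner s Bv Bv' + inner s Bv Bv.
  by rewrite (inner_lincombl hs) // !(inner_lincombr hs) // (innerC s Bv' Bv); ring.
have e5 := potential_semiconvex hs hF1 hF2 hd2 hp hc0 halpha ha hb hcF lv lf lv' lf'.
rewrite -/dv dv_sqr in e5.
rewrite innerC e1 e3 in e2.
have c20 : 0 < c ^+ 2 by rewrite exprn_gt0.
have kc' : k * c ^+ 2 <= 2 * eps by rewrite -ler_pdivlMr // ltW.
have h := ler_wpM2r (mulr_ge0 (ltW k0) (inner_ge0 s Bom')) kc'.
rewrite -subr_ge0 -(@pmulr_rge0 _ (8 * eps)) ?mulr_gt0 //.
have := young; rewrite e4.
move: e2 e5 h; rewrite /dv.
move: (inner s Bv' Bv') (inner s Bv Bv) (inner s Bv Bv') (inner s Bom' Bom') (inner s dBv Bom')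
  (inner s (f \o v') _) (potential s F v') (potential s F v).
move=> b' b bb w qr fd P' P e2 e5 h y.
have e5' := ler_wpM2l (ltW heps) e5.
have e2' : eps * (- k * w) = eps * (eps * (b' - bb) + fd) by rewrite e2.
lra.
Qed.

(** The difference of the potentials is tested with the increment; [young] absorbs $c\|v'-v\|^2$
    into $\varepsilon|v'-v|_1^2$ and $\frac{c^2k^2}{4\varepsilon}|\omega'|_1^2$. *)
Lemma potential_flux_step (Av om Bom Aom : E -> R) :
  chemical_potential v Bv Av om Bom Aom ->
  inner s Bom' Bom' - inner s Bom Bom <= c ^+ 2 / (2 * eps) * (k * inner s Bom' Bom').
Proof.
move=> level; case: level' => vB' BA' omB' BomA' [_ omE'].
case: level => _ BA omB BomA [_ omE].
have [lom lBom] := sqrt_op_in HB omB; have [_ lAv] := sqrt_op_in HB BA.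
have [_ lAom'] := sqrt_op_in HB BomA'.
have domB := sqrt_op_lincomb hs LLsub LLlin HB 1 (-1) omB' omB.
have ldom := LLlin 1 (-1) lom' lom.
have e1 : inner s (lincomb 1 om' (-1) om) dv
    = - k * (inner s Bom' Bom' - inner s Bom Bom').
  rewrite innerC (evol ldom) innerC (sqrt_op_sym HB domB BomA').
  by rewrite (inner_lincombl hs) //; ring.
have e2 : inner s (lincomb 1 om' (-1) om) dv
    = eps * inner s dBv dBv + inner s (lincomb 1 (f \o v') (-1) (f \o v)) dv.
  rewrite (inner_lincombl hs) // (omE' _ ldv) (omE _ ldv) (inner_lincombl hs) //.
  rewrite (innerC s Av') (innerC s Av) (sqrt_op_sym HB dvB BA') (sqrt_op_sym HB dvB BA).
  have -> : inner s dBv dBv = 1 * inner s dBv Bv' + -1 * inner s dBv Bv.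
    exact: inner_lincombr.
  by move: (inner s dBv Bv') (inner s dBv Bv) => x y; ring.
have e3 := nonlinearity_semimonotone hs hF2 hd2 lv lf lv' lf'.
rewrite -/dv dv_sqr in e3.
have e4 : 0 <= inner s Bom' Bom' - 2 * inner s Bom Bom' + inner s Bom Bom.
  have := inner_quadratic_ge0 hs 1 (-1) lBom' lBom; rewrite (innerC s Bom' Bom); lra.
rewrite mulrAC ler_pdivlMr ?mulr_gt0 // -(@ler_pM2r _ k) //.
have := young; move: e1 e2 e3 e4.
move: (inner s Bom' Bom') (inner s Bom Bom) (inner s Bom Bom') (inner s dBv dBv) (inner s dBv Bom')
  (inner s _ dv) (inner s (lincomb 1 (f \o v') (-1) (f \o v)) dv).
move=> w' w ww rr qr X Y e1 e2 e3 e4 y.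
have e3' := ler_wpM2l (ltW heps) e3.
have e4' := ler_wpM2l (ltW (mulr_gt0 heps k0)) e4.
have e2' : eps * (- k * (w' - ww)) = eps * (eps * rr + Y) by rewrite -e1 e2.
lra.
Qed.

Section Dual.
Local Notation K0 := (L2_zero_mean s).
Local Notation C := (sqrt_op s K0 (opG s)).
Hypothesis HC : is_sqrt_op s K0 (opG s) C.

Let K0sub : K0 `<=` LL. Proof. by move=> x []. Qed.
Let K0lin a b x y : K0 x -> K0 y -> K0 (lincomb a x b y).
Proof.
move=> [lx mx] [ly my]; split; first exact: LLlin.
by rewrite mean_lincomb // mx my !mulr0 addr0.
Qed.

Lemma dual_norm_step y y' : `|mean s v| <= alpha ->
  C (centered s v, y) -> C (centered s v', y') ->
  inner s y' y' - inner s y y <=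
  2 * k * ((c1 + c2a * alpha + c3) * vol s - (eps * inner s Bv' Bv' + potential s F v')).
Proof.
move=> mv Cv Cv'; case: level' => vB' BA' omB' BomA' [_ omE].
have [_ lAom'] := sqrt_op_in HB BomA'.
have mE : mean s v' = mean s v := euler_mean lv lv' BomA' evol.
(* This is $G(v'-v)$, read off from the scheme: $-k(\omega'-m(\omega'))$ has zero mean and $A$ sends
   it to $v'-v$. *)
pose psi := lincomb (- k) om' (k * mean s om') one.
have K0dv : K0 dv by split => //; rewrite mean_lincomb // mE; ring.
have K0psi : K0 psi.
  split; first by apply: LLlin => //; exact: L2_one.
  by rewrite mean_lincomb ?mean_one //; [ring|exact: L2_one].
have psiB := sqrt_opA_lincomb_one (- k) (k * mean s om') omB'.
have psiA : B (lincomb (- k) Bom' 0 Bom', dv).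
  apply: (sqrt_op_eq HB (sqrt_op_lincomb hs LLsub LLlin HB (- k) 0 BomA' BomA')) => //.
    exact: LLlin.
  by move=> x lx; rewrite (inner_lincombl hs) // mul0r addr0 (evol lx).
have Gdv : opG s (dv, psi) by split => //; exact: (sqrt_op_sqr HB psiB psiA).
have [z [dz zpsi]] : exists z, C (dv, z) /\ C (z, psi).
  by case: HC => _ _ _ _ TE; exact: (TE dv psi).1.
have Cdv : C (dv, lincomb 1 y' (-1) y).
  have := sqrt_op_lincomb hs K0sub K0lin HC 1 (-1) Cv' Cv.
  have -> // : lincomb 1 (centered s v') (-1) (centered s v) = dv.
  by apply/funext => x; rewrite /dv /lincomb /centered mE; ring.
have [K0y K0y'] : K0 y /\ K0 y' by have [_ ?] := sqrt_op_in HC Cv; have [_ ?] := sqrt_op_in HC Cv'.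
(* [z] and $y'-y$ are both values of $G^{1/2}$ at $v'-v$, so they agree when tested with $y'$. *)
have e1 : inner s y' y' - inner s y y' = inner s (centered s v') psi.
  rewrite (sqrt_op_sym HC Cv' zpsi) (innerC s y' z) -(sqrt_op_uniq hs K0sub K0lin HC Cdv dz K0y').
  by rewrite (inner_lincombl hs) //; [ring|exact: K0sub|exact: K0sub|exact: K0sub].
have lcv' := L2_centered lv'.
have e2 : inner s (centered s v') psi = - k * inner s om' (centered s v').
  rewrite (inner_lincombr hs) //; last exact: L2_one.
  by rewrite (inner_one_mean lcv') mean_centered // !mulr0 addr0 innerC.
have e3 : inner s om' (centered s v')
    = eps * inner s Bv' Bv' + inner s (f \o v') (centered s v').
  rewrite (omE _ lcv') (innerC s Av') {1}centeredE.
  rewrite (sqrt_op_sym HB (sqrt_opA_lincomb_one 1 (- mean s v') vB') BA').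
  by rewrite (inner_lincombl hs) //; ring.
have mv' : `|mean s v'| <= alpha by rewrite mE.
have e4 := inner_nonlinearity_centered hs hF1 hp hc0 halpha ha hb hcF lv' lf' mv'.
(* $\|y'-y\|^2\ge0$ bounds $(y'-y,y')$ below by half the difference of squares, whence the factor
   2. *)
have e5 := inner_quadratic_ge0 hs 1 (-1) (K0sub K0y') (K0sub K0y).
have e4' := ler_wpM2l (ltW k0) e4.
rewrite (innerC s y y') e2 e3 in e1.
lra.
Qed.

End Dual.
End TwoLevels.
End Step.
End Operators.

(** * Solutions of the scheme *)

Section Levels.
Context (R : realType) (d : nat) (s : setting R d) (hs : admissible s).
Local Notation E := 'rV[R]_d.
Local Notation LL := (L2 (dom s)).
Local Notation B := (sqrt_op s LL (opA s)).
Context (F : R -> R) (eps : R).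
Local Notation f := (derive1 F).
Hypothesis hF2 : forall x : R, derivable (derive1 F) x 1.

Lemma Hdot_sqrt_op m (v : E -> R) : Hdot s m.+1 v -> exists z, B (v, z).
Proof. by move=> [w [z [vz _]]]; exists z. Qed.

Lemma sqrt_op_Hdot1 (v z : E -> R) : is_sqrt_op s LL (opA s) B -> B (v, z) -> Hdot s 1 v.
Proof.
move=> HB vz; have [_ Lz] := sqrt_op_in HB vz.
by exists z; exists z; split => //; split => //=; apply: aeW => x.
Qed.

(** Turns the equations, valid almost everywhere, into identities tested against $L^2$. The
    sequences are shifted: [Bu n] and its companions belong to time level [n.+1]. *)
Lemma euler_levels (t : nat -> R) (u0 : E -> R) (u omega : nat -> E -> R) :
  time_mesh t -> Hdot s 2 u0 -> implicit_euler_solution s eps f t u0 u omega ->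
  exists Bu Au Bom Aom : nat -> E -> R, forall n,
    [/\ opA s (u n.+1, Au n),
        chemical_potential s F eps (u n.+1) (Bu n) (Au n) (omega n.+1) (Bom n) (Aom n),
        euler_relation s (step t n) (u n) (u n.+1) (Aom n)
      & LL (u n)].
Proof.
move=> ht hu0 [u0E hsol].
have [z0 uz0] := Hdot_sqrt_op hu0.
have HB := sqrt_opP uz0.
have Lu n : LL (u n).
  case: n => [|n]; first by rewrite u0E; case: (sqrt_op_in HB uz0).
  by have [/Hdot_sqrt_op[z uz] _] := hsol n; case: (sqrt_op_in HB uz).
have TE v w : opA s (v, w) <-> exists z, B (v, z) /\ B (z, w) by case: HB => _ _ _ _; apply.
suff H n : exists g : (E -> R) * (E -> R) * ((E -> R) * (E -> R)),
    [/\ opA s (u n.+1, g.1.2),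
        chemical_potential s F eps (u n.+1) g.1.1 g.1.2 (omega n.+1) g.2.1 g.2.2,
        euler_relation s (step t n) (u n) (u n.+1) g.2.2
      & LL (u n)].
  have [G HG] := choice H.
  by exists (fun n => (G n).1.1), (fun n => (G n).1.2), (fun n => (G n).2.1), (fun n => (G n).2.2).
have [_ [Au [Aom [uA oA ev om]]]] := hsol n.
have [Bu [uB BA]] := (TE _ _).1 uA; have [Bo [oB BoA]] := (TE _ _).1 oA.
exists (Bu, Au, (Bo, Aom)) => /=.
have [_ lAu] := sqrt_op_in HB BA; have [lo _] := sqrt_op_in HB oB.
have [_ lAo] := sqrt_op_in HB BoA.
(* The equation itself puts $f(u^{n+1})=\omega^{n+1}-\varepsilon Au^{n+1}$ in $L^2$. *)
have lf : LL (f \o u n.+1).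
  apply: (@L2_ae _ _ _ hs (lincomb 1 (omega n.+1) (- eps) Au)).
  - by apply: measurable_comp_continuous => //; exact: derive1_continuous_of_derivable2.
  - by apply: filterS om => x om Dx; rewrite /lincomb om //=; ring.
  - exact: L2_lincomb.
split => //; first split => //; first split => //.
  move=> x lx; rewrite (@inner_ae _ _ _ hs (omega n.+1) (lincomb eps Au 1 (f \o u n.+1))) //.
  - by rewrite (inner_lincombl hs) // mul1r.
  - exact: L2_lincomb.
  - by apply: filterS om => y om Dy; rewrite /lincomb om //= mul1r.
move=> x lx.
have k0 := step_gt0 ht n.
rewrite (@inner_ae _ _ _ hs _ (lincomb (- step t n) Aom 0 Aom)) //.
- by rewrite (inner_lincombl hs) // mul0r addr0.
- exact: L2_lincomb.
- exact: L2_lincomb.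
- apply: filterS ev => y ev Dy; rewrite /lincomb; have /= := ev Dy => h.
  have -> : Aom y = - ((u n.+1 y - u n y) / step t n) by lra.
  by field; rewrite gt_eqF.
Qed.

(** The function is $\varepsilon\Delta v=f(v)-\omega$ as a class in $L^2$, and both terms are in the
    domain of $A^{1/2}$. *)
Lemma Hnorm1_laplacian_le (v Bv Av om Bom Aom : E -> R) (M N : R) :
  is_sqrt_op s LL (opA s) B ->
  chemical_potential s F eps v Bv Av om Bom Aom ->
  (Hnorm s 1 (f \o v) <= M%:E)%E -> norm2 s Bom <= N ->
  (Hnorm s 1 (fun x => eps * (\- Av) x)%R <= (N + M)%:E)%E.
Proof.
move=> HB [vB BA omB BomA [lf omE]] fM oN.
have [_ lAv] := sqrt_op_in HB BA; have [lom lBom] := sqrt_op_in HB omB.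
have [phi0 [phi [fphi _]]] := op_norm_lty (le_lt_trans fM (ltry M)).
have [_ lphi] := sqrt_op_in HB fphi.
rewrite (Hnorm1E hs HB fphi) lee_fin in fM.
have LLsub : LL `<=` LL by [].
have LLlin a b x y : LL x -> LL y -> LL (lincomb a x b y) by exact: L2_lincomb.
have wE : (fun x => eps * (\- Av) x)%R = lincomb (- eps) Av 0 Av.
  by apply/funext => x; rewrite /lincomb /=; ring.
have wB : B (lincomb (- eps) Av 0 Av, lincomb 1 phi (-1) Bom).
  apply: (sqrt_op_eq HB (sqrt_op_lincomb hs LLsub LLlin HB 1 (-1) fphi omB)) => //.
  - exact: LLlin.
  - exact: LLlin.
  by move=> x lx; rewrite !(inner_lincombl hs) // omE //; ring.
rewrite wE (Hnorm1E hs HB wB) lee_fin.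
apply: le_trans (norm2_triangle hs 1 (-1) lphi lBom) _.
by rewrite normrN normr1; lra.
Qed.

End Levels.

(** Here $\rho_0^2=2C_1T$. The lower bound on [t] brings the exponential term below $\rho_0^2$, so
    the sum is at most $\frac32\rho_0^2\le4\rho_0^2$. *)
Lemma absorbing_radius (R : realType) (x t T rad C1 : R) :
  0 < C1 -> 0 < T -> 0 < rad ->
  let rho0 := Num.sqrt (2 * C1) * Num.sqrt T in
  T * ln (rad ^+ 2 / rho0 ^+ 2) <= t ->
  x <= expR (- (t / T)) * rad ^+ 2 + C1 * T -> x <= (2 * rho0) ^+ 2.
Proof.
move=> C0 T0 r0 rho0.
have rhoE : rho0 ^+ 2 = 2 * C1 * T.
  by rewrite /rho0 exprMn !sqr_sqrtr // ltW // mulr_gt0.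
have CT : 0 < C1 * T by exact: mulr_gt0.
move: rho0 rhoE => rho0 rhoE.
rewrite exprMn rhoE => tT.
have rad2 : 0 < rad ^+ 2 by rewrite exprn_gt0.
have q0 : 0 < rad ^+ 2 / (2 * C1 * T) by rewrite divr_gt0 //; lra.
rewrite mulrC -ler_pdivlMr // -ler_expR lnK ?posrE // in tT.
have e0 := expR_gt0 (t / T).
rewrite expRN => h; apply: (le_trans h).
have : (expR (t / T))^-1 * rad ^+ 2 <= 2 * C1 * T.
  rewrite mulrC ler_pdivrMr // mulrC -ler_pdivrMr //; lra.
lra.
Qed.

(** * Choice of the indices and assembly of the bounds *)

Unset Implicit Arguments.
Set Strict Implicit.
Set Printing Implicit Defensive.

Theorem theorem4p11 (R : realType) (d : nat) (hd : (1 <= d <= 3)%N)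
    (s : setting R d) (hs : admissible s)
    (gamma1 : R) (hgamma1 : 0 < gamma1)
    (hdual : forall v : 'rV[R]_d -> R, Hdot s 1 v ->
      (Hnorm_m1 s (centered s v) <= gamma1%:E * Hnorm s 1 v)%E)
    (eps : R) (heps : 0 < eps)
    (p : nat) (hp : (2 <= p)%N) (hp3 : d = 3%N -> p = 2%N)
    (F : R -> R)
    (hF1 : forall x : R, derivable F x 1) (hF2 : forall x : R, derivable (derive1 F) x 1)
    (hFc : continuous (derive1n 2 F)) (hF0 : F 0 = 0)
    (c0 c1 : R) (c2 : R -> R) (c3 c : R) (hc0 : 0 < c0) (hc : 0 < c)
    (ha : forall v, p%:R * c0 * v ^+ (2 * p) - c1 <= (derive1 F) v * v)
    (hb : forall eta : R, 0 < eta ->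
      forall v, `|(derive1 F) v| <= eta * c0 * v ^+ (2 * p) + c2 eta)
    (hcF : forall v, 1 / 2 * c0 * v ^+ (2 * p) - c3 <= F v
                  /\ F v <= 3 / 2 * c0 * v ^+ (2 * p) + c3)
    (hd2 : forall v, - c <= derive1n 2 F v)
    (rad rad2 alpha r : R) (hrad : 0 < rad) (hrad2 : 0 < rad2)
    (halpha : 0 < alpha) (hr : 0 < r) :
  let f : R -> R := (derive1 F) in
  let c2a : R := c2 (1 / alpha * (p%:R - 3 / 2)) in
  let C0 : R := (c1 + c2a * alpha + c3) * vol s in
  let C1 : R := (c1 + c2a * alpha + 2 * c3) * vol s in
  let T : R := gamma1 ^+ 2 / eps + 8 * eps / c ^+ 2 in
  let rho0 : R := Num.sqrt (2 * C1) * Num.sqrt T in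
  let rho0' : R := 2 * rho0 in
  let C2 : R := C0 + rho0' ^+ 2 / (2 * r) in
  let rho1 : R := Num.sqrt (2 / eps * C1 + rho0' ^+ 2 / (r * eps)) in
  forall t : nat -> R, time_mesh t ->
  (ereal_sup (range (fun n => (step t n)%:E)) < (2 * eps / c ^+ 2)%:E)%E ->
  forall n0 : nat, (0 < n0)%N -> T * ln (rad ^+ 2 / rho0 ^+ 2) <= t n0 ->
  forall (u0 : 'rV[R]_d -> R) (u omega : nat -> 'rV[R]_d -> R),
  Hdot s 2 u0 ->
  implicit_euler_solution s eps f t u0 u omega ->
  (Hnorm s 2 u0 <= rad2%:E)%E ->
  (Hnorm_m1 s (centered s u0) <= rad%:E)%E ->
  `|mean s u0| <= alpha ->
  forall gamma6 gamma7 : R, 0 < gamma6 -> 0 < gamma7 ->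
  (forall n, (1 <= n)%N -> forall w, laplacian s (u n, w) ->
     (Hnorm s 3 (u n) <= gamma6%:E * Hnorm s 1 (fun x => eps * w x)%R)%E) ->
  (forall n, (1 <= n)%N ->
     (Hnorm s 1 (f \o u n) <= gamma7%:E * Hnorm s 1 (u n))%E) ->
  exists n1 N1 nomega : nat,
    let r1 : R := t nomega - t (n0 + N1)%N in
    let rhoomega : R := Num.sqrt
      ((c ^+ 2 / (4 * eps) * C1 + c ^+ 2 * rho0' ^+ 2 / (8 * eps * r1) + C2 / r1)
       * expR (2 * c ^+ 2 * r1 / eps)) in
    [/\ (0 < n1)%N, (0 < N1)%N & (0 < nomega)%N] /\
    r <= t (n0 + N1)%N - t n0 /\
    0 < r1 /\
    (forall n, (n1 <= n)%N -> (Hnorm s 1 (u n) <= rho1%:E)%E) /\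
    (forall n, (nomega <= n)%N -> (Hnorm s 1 (omega n) <= rhoomega%:E)%E) /\
    (forall n, (maxn nomega n1 <= n)%N ->
       (Hnorm s 3 (u n) <= (gamma6 * rhoomega + gamma6 * gamma7 * rho1)%:E)%E).
Proof.
move=> f c2a C0 C1 T rho0 rho0' C2 rho1 t ht hstep n0 n0_gt0 hn0 u0 u omega
  hu0 hsol _ hrad0 hmean0 gamma6 gamma7 hgamma6 hgamma7 hnorm3 hnormf.
have hp2 : (2 : R) <= p%:R by rewrite ler_nat.
have heta : 0 < 1 / alpha * (p%:R - 3 / 2) by rewrite mulr_gt0 ?divr_gt0 //; lra.
have hb' := hb _ heta.
have [c1_ge0 c2_ge0 c3_ge0 growth_gt0] := growth_constant_gt0 hp hc0 halpha ha hb' hcF.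
have vol0 := vol_gt0 hs.
have C1_gt0 : 0 < C1 by exact: mulr_gt0.
have C0_ge0 : 0 <= C0.
  by rewrite /C0 mulr_ge0 ?(ltW vol0) // !addr_ge0 // mulr_ge0 // ltW.
have C1E : C1 = C0 + c3 * vol s by rewrite /C1 /C0; ring.
have c2_gt0 : 0 < c ^+ 2 by rewrite exprn_gt0.
have T_gt0 : 0 < T by rewrite addr_gt0 // divr_gt0 ?exprn_gt0 // mulr_gt0.
have hk n : step t n < 2 * eps / c ^+ 2.
  by rewrite -lte_fin (le_lt_trans _ hstep) //; apply: ereal_sup_ubound; exists n.
have [Bu [Au [Bom [Aom levels]]]] := euler_levels hs hF2 ht hu0 hsol.
have [z0 uz0] := Hdot_sqrt_op hu0; have HB := sqrt_opP uz0.
have k_gt0 := step_gt0 ht.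
have uB n : sqrt_op s (L2 (dom s)) (opA s) (u n.+1, Bu n) by case: (levels n) => _ [].
have oB n : sqrt_op s (L2 (dom s)) (opA s) (omega n.+1, Bom n) by case: (levels n) => _ [].
have lf n : L2 (dom s) (f \o u n.+1) by case: (levels n) => _ [_ _ _ _ []].
have meanE n : mean s (u n) = mean s u0.
  elim: n => [|n IH]; first by case: hsol => ->.
  have [_ [_ _ _ BA _] ev lu] := levels n; have [_ _ _ lu'] := levels n.+1.
  by rewrite -IH; exact: (euler_mean hs HB lu lu' BA ev).
have hmean n : `|mean s (u n)| <= alpha by rewrite meanE.
have [y0 uy0] := op_norm_lty (le_lt_trans hrad0 (ltry rad)).
have HC := sqrt_opP uy0.
have K0sub : L2_zero_mean s `<=` L2 (dom s) by move=> x [].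
have K0lin a b x y : L2_zero_mean s x -> L2_zero_mean s y -> L2_zero_mean s (lincomb a x b y).
  move=> [lx mx] [ly my]; split; first exact: L2_lincomb.
  by rewrite (mean_lincomb hs) // mx my !mulr0 addr0.
have dual_lty n : (Hnorm_m1 s (centered s (u n.+1)) <= (gamma1 * norm2 s (Bu n))%:E)%E.
  rewrite EFinM -(Hnorm1E hs HB (uB n)); apply: hdual.
  exact: (sqrt_op_Hdot1 HB (uB n)).
have dual_ex n : exists y, sqrt_op s (L2_zero_mean s) (opG s) (centered s (u n), y).
  case: n => [|n]; first by exists y0; case: hsol => ->.
  exact: (op_norm_lty (le_lt_trans (dual_lty n) (ltry _))).
have [Y HY] := boolp.choice dual_ex.
have dualE n := op_norm_sqrt_op hs K0sub K0lin HC (HY n).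
pose a n := inner s (Y n) (Y n).
(* [Bu] and [Bom] are shifted by one, so [b n] and [w n] are $|u^n|_1^2$ and $|\omega^n|_1^2$ for
   positive [n] only; the value at 0 is a dummy, and inequalities using it are restricted to
   positive indices. *)
pose b n := inner s (Bu n.-1) (Bu n.-1).
pose w n := inner s (Bom n.-1) (Bom n.-1).
pose Phi n := potential s F (u n).
pose J n := eps / 2 * b n + Phi n.
have b_ge0 n : 0 <= b n by exact: inner_ge0.
have Phi_ge n : - (c3 * vol s) <= Phi n.+1.
  by have [_ _ _ lu] := levels n.+1;
  exact: (potential_ge hs hF1 hp hc0 halpha ha hb' hcF lu (lf n)).
have uBex n : exists z, sqrt_op s (L2 (dom s)) (opA s) (u n, z).
  by case: n => [|n]; [exists z0; case: hsol => ->|exists (Bu n)].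
have dual_decay n : a n.+1 - a n <= 2 * step t n * (C0 - (eps * b n.+1 + Phi n.+1)).
  have [_ level ev _] := levels n; have [z uz] := uBex n.
  exact: (dual_norm_step hs HB hF1 hp hc0 halpha ha hb' hcF (k_gt0 n) uz level ev HC
    (hmean n) (HY n) (HY n.+1)).
have energy_decay n : (0 < n)%N -> J n.+1 + 3 / 4 * (step t n * w n.+1) <= J n.
  case: n => // n _; have [_ level ev _] := levels n.+1.
  exact: (energy_step hs HB hF1 hF2 hd2 hp hc0 hc halpha heps ha hb' hcF (k_gt0 n.+1)
    (uB n) (lf n) level ev (hk n.+1)).
have flux_growth n : (0 < n)%N ->
    w n.+1 - w n <= c ^+ 2 / (2 * eps) * (step t n * w n.+1).
  case: n => // n _; have [_ level' ev _] := levels n.+1; have [_ level _ _] := levels n.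
  exact: (potential_flux_step hs HB hF2 hd2 heps (k_gt0 n.+1) (uB n) (lf n) level' ev level).
have w_ge0 n : 0 <= w n by exact: inner_ge0.
have J_decr n : (0 < n)%N -> J n.+1 <= J n.
  by move=> n_gt0; have := energy_decay n n_gt0; have := mulr_ge0 (ltW (k_gt0 n)) (w_ge0 n.+1); lra.
have J_mono m n : (0 < m)%N -> (m <= n)%N -> J n <= J m.
  move=> m_gt0 /subnKC <-; elim: (n - m)%N => [|i IH]; first by rewrite addn0.
  by rewrite addnS; apply: le_trans IH; apply: J_decr; rewrite addn_gt0 m_gt0.
have J_ge n : (0 < n)%N -> - (c3 * vol s) <= J n.
  by case: n => // n _; have := Phi_ge n; have := mulr_ge0 (ltW heps) (b_ge0 n.+1); rewrite /J; lra.
have a_ge0 n : 0 <= a n by exact: inner_ge0.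
(* The extra $c_3|\Omega|$ in $C_1$ compensates the lower bound of $\int F(u)$. *)
have a_decay n : a n.+1 - a n <= 2 * step t n * (C1 - eps * b n.+1).
  apply: le_trans (dual_decay n) _; rewrite ler_pM2l ?mulr_gt0 //.
  by have := Phi_ge n; rewrite C1E; lra.
have a_le_b n : a n.+1 <= gamma1 ^+ 2 * b n.+1.
  have := dual_lty n; rewrite /Hnorm_m1 dualE lee_fin /a /b => h.
  rewrite -!norm2_sqr -exprMn ler_pXn2r ?nnegrE ?norm2_ge0 // mulr_ge0 ?norm2_ge0 //.
  exact: ltW.
have a0_le : a 0%N <= rad ^+ 2.
  have e0 : u 0%N = u0 by case: hsol.
  have := hrad0; rewrite -e0 /Hnorm_m1 dualE lee_fin /a => h.
  by rewrite -norm2_sqr ler_pXn2r ?nnegrE ?norm2_ge0 // ltW.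
have an0 : a n0 <= rho0' ^+ 2.
  apply: (absorbing_radius C1_gt0 T_gt0 hrad hn0).
  exact: (decay_bound ht hgamma1 heps hc (ltW C1_gt0) hk a_decay a_le_b a0_le).
have [m n0m tm] := mesh_unbounded ht (t n0 + r) n0.
pose N1 := (m - n0)%N.
have mE : (n0 + N1)%N = m by rewrite /N1 subnKC // ltnW.
have m_gt0 : (0 < m)%N by exact: leq_ltn_trans n0m.
have dt_r : r <= t m - t n0 by lra.
(* As $a_m\ge0$, averaging gives $2(t^m-t^{n_0})(J_m-C_0)\le(\hat\rho_0')^2$ with $t^m-t^{n_0}\ge
   r$. *)
have Jm : J m <= C2.
  have := energy_average ht N1 heps n0_gt0 b_ge0 dual_decay J_decr.
  rewrite mE -/(J m) => h; rewrite /C2 -lerBlDl.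
  have [JC|CJ] := leP (J m - C0) 0.
    by apply: le_trans JC _; rewrite divr_ge0 ?sqr_ge0 // mulr_ge0 // ltW.
  rewrite ler_pdivlMr ?mulr_gt0 //.
  have := ler_wpM2r (ltW CJ) dt_r; have := a_ge0 m; lra.
(* From $J_n\le C_2$ and $\int F\ge-c_3|\Omega|$: $\varepsilon
   b_n\le2(C_2+c_3|\Omega|)=2C_1+(\hat\rho_0')^2/r$. *)
have b_le n : (m <= n)%N -> norm2 s (Bu n.-1) <= rho1.
  move=> mn; rewrite /norm2 ler_wsqrtr // -/(b n).
  have n_gt0 : (0 < n)%N by exact: leq_trans mn.
  have Jn := J_mono m n m_gt0 mn.
  have Pn : - (c3 * vol s) <= Phi n by case: (n) n_gt0 => // i _; exact: Phi_ge.
  have h : eps * b n <= 2 * C1 + rho0' ^+ 2 / r.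
    have e : 2 * (rho0' ^+ 2 / (2 * r)) = rho0' ^+ 2 / r by field; rewrite gt_eqF.
    by move: Jn Jm; rewrite /J /C2 C1E -e; lra.
  rewrite -(@ler_pM2l _ eps) //; apply: le_trans h _; rewrite le_eqVlt; apply/orP; left.
  by apply/eqP; field; rewrite !gt_eqF.
have tau_gt0 : 0 < c ^+ 2 / (4 * eps) * C1 by rewrite mulr_gt0 // divr_gt0 // mulr_gt0.
have D_gt0 : 0 < c ^+ 2 / (2 * eps) by rewrite divr_gt0 // mulr_gt0.
(* The threshold is the first summand of $\rho_\omega^2$, which is independent of $r_1$ and hence
   known before [nw] is chosen; taking [nw] beyond [m] makes $r_1$ positive. *)
have [nw mnw w_le] := dissipation_small ht m D_gt0 tau_gt0 w_ge0 J_ge flux_growth energy_decay.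
exists m, N1, nw => r1 rhoomega.
have nw_gt0 : (0 < nw)%N by exact: leq_ltn_trans mnw.
have r1_gt0 : 0 < r1.
  rewrite /r1 mE subr_gt0; apply: lt_le_trans (mesh_le ht mnw).
  by have := k_gt0 m; rewrite /step subr_gt0.
have om_le n : (nw <= n)%N -> norm2 s (Bom n.-1) <= rhoomega.
  move=> nwn; rewrite /norm2 ler_wsqrtr // -/(w n); apply: le_trans (w_le n nwn) _.
  set tau := c ^+ 2 / (4 * eps) * C1 in tau_gt0 *.
  have X1 : 0 <= c ^+ 2 * rho0' ^+ 2 / (8 * eps * r1).
    by rewrite divr_ge0 ?mulr_ge0 ?sqr_ge0 // ltW.
  have X2 : 0 <= C2 / r1.
    by rewrite divr_ge0 ?(ltW r1_gt0) // addr_ge0 // divr_ge0 ?sqr_ge0 // mulr_ge0 // ltW.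
  have X3 : 1 <= expR (2 * c ^+ 2 * r1 / eps).
    by rewrite -expR0 ler_expR divr_ge0 ?mulr_ge0 ?sqr_ge0 // ltW.
  rewrite -[leLHS]mulr1; apply: ler_pM => //; [exact: ltW|lra].
split; first by split => //; rewrite subn_gt0.
split; first by rewrite mE.
split => //; split => [n mn|].
  have n_gt0 : (0 < n)%N by exact: leq_trans mn.
  by have := b_le n mn; case: n n_gt0 {mn} => // n _; rewrite (Hnorm1E hs HB (uB n)) lee_fin.
split => [n nwn|n].
  have n_gt0 : (0 < n)%N by exact: leq_trans nwn.
  by have := om_le n nwn; case: n n_gt0 {nwn} => // n _; rewrite (Hnorm1E hs HB (oB n)) lee_fin.
rewrite geq_max => /andP[nwn mn].
have n_gt0 : (0 < n)%N by exact: leq_trans mn.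
have := b_le n mn; have := om_le n nwn; case: n n_gt0 {nwn mn} => // n _ /= on bn.
have [uA level _ _] := levels n.
apply: le_trans (hnorm3 n.+1 isT _ uA) _.
have fM : (Hnorm s 1 (f \o u n.+1) <= (gamma7 * rho1)%:E)%E.
  apply: le_trans (hnormf n.+1 isT) _.
  by rewrite (Hnorm1E hs HB (uB n)) -EFinM lee_fin ler_pM2l.
have := Hnorm1_laplacian_le hs HB level fM on.
rewrite -mulrA -mulrDr EFinM lee_pmul2l ?lte_fin //.
Qed.
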